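(* Let $\mathcal{RB}$ be the category of the relational bialgebraic monad freely generated by a single object, let $\mathcal{RB}_{\mathrm I}$ be the syntactically defined category described in the context, and let $\mathit{Rel}$ be the category whose objects are the finite ordinals and whose arrows $n\to m$ are the binary relations $R\subseteq n\times m$, with the usual composition of relations. The categories $\mathcal{RB}$, $\mathcal{RB}_{\mathrm I}$ and $\mathit{Rel}$ are isomorphic.
   Context: Notation: $\circ$ is composition of arrows; $\mathbf 1$ denotes identity arrows; for a natural transformation $\theta$ and functors $F,M$, $\theta_F$ has components $\theta_{Fa}$ and $M\theta$ has components $M(\theta_a)$. Finite ordinals are $n=\{0,\dots,n-1\}$. Composition of relations: $R_2\circ R_1=\{(x,y):\exists z\,((x,z)\in R_1\ \&\ (z,y)\in R_2)\}$. **Relational bialgebraic monad.** This is a category $\mathcal A$ with an endofunctor $M$ and natural transformations $\nabla:MM\to M$, $\Delta:M\to MM$, $u:I\to M$, $\varepsilon:M\to I$, $\tau:MM\to MM$ ($I$ the identity functor) satisfying the following. Monad: $\nabla\circ\nabla_M=\nabla\circ M\nabla$, $\nabla\circ u_M=\mathbf 1_M=\nabla\circ Mu$. Comonad: $\Delta_M\circ\Delta=M\Delta\circ\Delta$, $\varepsilon_M\circ\Delta=\mathbf 1_M=M\varepsilon\circ\Delta$. Symmetry: $\tau\circ\tau=\mathbf 1_{MM}$, $M\tau\circ\tau_M\circ M\tau=\tau_M\circ M\tau\circ\tau_M$, $\nabla\circ\tau=\nabla$, $\tau\circ\Delta=\Delta$, $\tau\circ\nabla_M=M\nabla\circ\tau_M\circ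 M\tau$, $\Delta_M\circ\tau=M\tau\circ\tau_M\circ M\Delta$, $\tau\circ u_M=Mu$, $\varepsilon_M\circ\tau=M\varepsilon$. Bialgebraic homomorphism equations: $\varepsilon\circ u=\mathbf 1_I$, $\varepsilon\circ\nabla=\varepsilon\circ M\varepsilon$, $\Delta\circ u=Mu\circ u$, $\Delta\circ\nabla=M\nabla\circ\nabla_{MM}\circ M\tau_M\circ MM\Delta\circ\Delta_M$. Bialgebraic separability: $\nabla\circ\Delta=\mathbf 1_M$. **RB.** $\mathcal{RB}$ is the free relational bialgebraic monad on one object $0$: its objects are $M^n0$, identified with $n\ge 0$; its arrow terms are built from the components at all objects $n$ of the natural transformations $\nabla,\Delta,u,\varepsilon,\tau$ and from identities, by composition and by applying $M$; its arrows are the equivalence classes of arrow terms under the least congruence (for composition and $M$) validating the category axioms, functoriality of $M$, naturality of $\nabla,\Delta,u,\varepsilon,\tau$, and, at all objects, all the equations required in the definition of a relational bialgebraic monad (the monad, comonad, symmetry, bialgebraic homomorphism and bialgebraic separability equations). **$\mathcal{RB}_{\mathrm I}$.** Objects: finite ordinals. Primitive arrow terms, for all $n,m,k\ge0$: ${}_n\mathbf 1_m:n+m\to n+m$; ${}_n\nabla^k_m:n+2k+m\to n+k+m$; ${}_n\Delta^k_m:n+k+m\to n+2k+m$; ${}_nu^k_m:n+m\to n+k+m$; ${}_n\varepsilon^k_m:n+k+m\to n+m$. Arrow terms are closed under composition of terms of matching type (parentheses are not written, so composition is associative). Set ${}_n({}_k\theta_l)_m={}_{n+k}\theta_{l+m}$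 for primitive $\theta$, and ${}_n(g\circ f)_m={}_ng_m\circ{}_nf_m$; a subscript $0$ is omitted. For $f:n\to m$ and $g:k\to l$, $f+g$ is $f_l\circ{}_ng:n+k\to m+l$ (equal in $\mathcal{RB}_{\mathrm I}$ to ${}_mg\circ f_k$, because the equations imposed on arrow terms include ${}_{q+r}\theta\circ\xi_{r+s}=\xi_{r+t}\circ{}_{p+r}\theta$ for $\xi:p\to q$, $\theta:s\to t$ each of one of the forms $\nabla^k,\Delta^k,u^k,\varepsilon^k$, $r\ge0$). Arrows are equivalence classes of arrow terms under the least equivalence relation (between terms of the same type) closed under the rules ''if $f=g$ then ${}_nf_m={}_ng_m$'' and ''if $f=g$ and $f'=g'$ then $f'\circ f=g'\circ g$'' and containing, for all $f:n\to m$ and all $k,l\geq 0$: - $f\circ\mathbf 1_n=f=\mathbf 1_m\circ f$; ${}_1\mathbf 1=\mathbf 1_1$; - ${}_{q+r}\theta\circ\xi_{r+s}=\xi_{r+t}\circ{}_{p+r}\theta$ for $\xi:p\to q$, $\theta:s\to t$ each of one of the forms $\nabla^k,\Delta^k,u^k,\varepsilon^k$ (for any $k$), $r\ge0$; - $f\circ\nabla^n=\nabla^m\circ(f+f)$; $\Delta^m\circ f=(f+f)\circ\Delta^n$; $f\circ u^n=u^m$; $\varepsilon^m\circ f=\varepsilon^n$; - $\nabla^k\circ{}_ku^k=\mathbf 1_k$; $\nabla^k\circ u^k_k=\mathbf 1_k$; $\nabla^{k+l}\circ({}_ku^l+u^k_l)=\mathbf 1_{k+l}$; - ${}_k\varepsilon^k\circ\Delta^k=\mathbf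 1_k$; $\varepsilon^k_k\circ\Delta^k=\mathbf 1_k$; $({}_k\varepsilon^l+\varepsilon^k_l)\circ\Delta^{k+l}=\mathbf 1_{k+l}$; - $u^0=\varepsilon^0=\mathbf 1$ (identity of $0$); $\nabla^k\circ\Delta^k=\mathbf 1_k$. *)

(* Defs.v *)
From HB Require Import structures.
From mathcomp Require Import all_boot.
From mathcomp Require Import boolp.

Set Implicit Arguments.
Unset Strict Implicit.
Unset Printing Implicit Defensive.
#[local] Obligation Tactic := idtac.

Local Open Scope nat_scope.
Local Open Scope quotient_scope.

Reserved Notation "g ∘ f" (at level 40, left associativity).
Reserved Notation "s ≡ t" (at level 70, no associativity).

Record category := Category {
  obj :> Type;
  hom : obj -> obj -> Type;
  cid : forall a, hom a a;
  ccomp : forall a b c, hom b c -> hom a b -> hom a c;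
  ccompA : forall a b c d (h : hom c d) (g : hom b c) (f : hom a b),
    ccomp h (ccomp g f) = ccomp (ccomp h g) f;
  ccomp1f : forall a b (f : hom a b), ccomp (cid b) f = f;
  ccompf1 : forall a b (f : hom a b), ccomp f (cid a) = f }.

Arguments hom {C} _ _ : rename.
Arguments cid {C} _ : rename.
Arguments ccomp {C a b c} _ _ : rename.

Record functor (C D : category) := Functor {
  fobj :> C -> D;
  fhom : forall a b, hom a b -> hom (fobj a) (fobj b);
  fhom1 : forall a, fhom (cid a) = cid (fobj a);
  fhomM : forall a b c (g : hom b c) (f : hom a b),
    fhom (ccomp g f) = ccomp (fhom g) (fhom f) }.

Definition functor_id (C : category) : functor C C :=
  @Functor C C id (fun a b => id) (fun a => erefl) (fun a b c g f => erefl).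

Program Definition functor_comp (C D E : category)
    (G : functor D E) (F : functor C D) : functor C E :=
  @Functor C E (fun a => G (F a)) (fun a b f => fhom G (fhom F f)) _ _.
Next Obligation. by move=> C D E G F a /=; rewrite !fhom1. Qed.
Next Obligation. by move=> C D E G F a b c g f /=; rewrite !fhomM. Qed.

Definition isomorphic (C D : category) : Prop :=
  exists (F : functor C D) (G : functor D C),
    functor_comp G F = functor_id C /\ functor_comp F G = functor_id D.

Record presentation := Presentation {
  pobj : Type;
  pterm : pobj -> pobj -> Type;
  pid : forall a, pterm a a;
  pcomp : forall a b c, pterm b c -> pterm a b -> pterm a c;
  peq : forall a b, pterm a b -> pterm a b -> Prop;
  peq_refl : forall a b (f : pterm a b), peq f f;
  peq_sym : forall a b (f g : pterm a b), peq f g -> peq g f;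
  peq_trans : forall a b (f g h : pterm a b), peq f g -> peq g h -> peq f h;
  peq_comp : forall a b c (g g' : pterm b c) (f f' : pterm a b),
    peq g g' -> peq f f' -> peq (pcomp g f) (pcomp g' f');
  peq_compA : forall a b c d (h : pterm c d) (g : pterm b c) (f : pterm a b),
    peq (pcomp h (pcomp g f)) (pcomp (pcomp h g) f);
  peq_comp1f : forall a b (f : pterm a b), peq (pcomp (pid b) f) f;
  peq_compf1 : forall a b (f : pterm a b), peq (pcomp f (pid a)) f }.

Section QuotientCategory.
Variable P : presentation.

(* This is [peq] made boolean by excluded middle, as {eq_quot _} requires. *)
Definition peqb (a b : pobj P) : rel {classic (pterm a b)} :=
  fun f g => `[< peq (f : pterm a b) g >].

Lemma peqb_refl a b : reflexive (@peqb a b).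
Proof. by move=> f; apply/asboolP/peq_refl. Qed.

Lemma peqb_sym a b : symmetric (@peqb a b).
Proof. by move=> f g; apply/asboolP/asboolP => /peq_sym. Qed.

Lemma peqb_trans a b : transitive (@peqb a b).
Proof.
move=> g f h /asboolP fg /asboolP gh; apply/asboolP.
exact: (peq_trans fg gh).
Qed.

Canonical peq_equiv a b :=
  EquivRel (@peqb a b) (@peqb_refl a b) (@peqb_sym a b) (@peqb_trans a b).

Definition qhom (a b : pobj P) : Type := {eq_quot (peq_equiv a b)}.

Definition qclass a b (f : pterm a b) : qhom a b :=
  \pi_({eq_quot (peq_equiv a b)}) (f : {classic (pterm a b)}).

Definition qrepr a b (f : qhom a b) : pterm a b :=
  repr (f : {eq_quot (peq_equiv a b)}).

Lemma qclassP a b (f g : pterm a b) : qclass f = qclass g <-> peq f g.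
Proof.
split=> [/eqP|fg]; first by rewrite /qclass eqmodE /= => /asboolP.
by apply/eqP; rewrite /qclass eqmodE /=; apply/asboolP.
Qed.

Lemma qreprK a b (f : qhom a b) : qclass (qrepr f) = f.
Proof. exact: reprK. Qed.

Definition qcomp a b c (g : qhom b c) (f : qhom a b) : qhom a c :=
  qclass (pcomp (qrepr g) (qrepr f)).

Lemma qcompE a b c (g : pterm b c) (f : pterm a b) :
  qcomp (qclass g) (qclass f) = qclass (pcomp g f).
Proof. by apply/qclassP/peq_comp; apply/qclassP; rewrite qreprK. Qed.

Lemma qcompA a b c d (h : qhom c d) (g : qhom b c) (f : qhom a b) :
  qcomp h (qcomp g f) = qcomp (qcomp h g) f.
Proof.
rewrite -[h]qreprK -[g]qreprK -[f]qreprK !qcompE.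
exact/qclassP/peq_compA.
Qed.

Lemma qcomp1f a b (f : qhom a b) : qcomp (qclass (pid b)) f = f.
Proof. by rewrite -[f]qreprK qcompE; exact/qclassP/peq_comp1f. Qed.

Lemma qcompf1 a b (f : qhom a b) : qcomp f (qclass (pid a)) = f.
Proof. by rewrite -[f]qreprK qcompE; exact/qclassP/peq_compf1. Qed.

Definition quotient_category : category :=
  @Category (pobj P) qhom (fun a => qclass (pid a)) qcomp
    qcompA qcomp1f qcompf1.

End QuotientCategory.

(* Arrow terms of the relational bialgebraic monad freely generated by one
   object 0. The object M^n 0 is n, so that M acts on objects as successor and
   the component of th_M at n is th n.+1. *)
Inductive rb_term : nat -> nat -> Type :=
| RbId n : rb_term n n
| RbComp n m k : rb_term m k -> rb_term n m -> rb_term n k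
| RbM n m : rb_term n m -> rb_term n.+1 m.+1
| RbNabla n : rb_term n.+2 n.+1
| RbDelta n : rb_term n.+1 n.+2
| RbU n : rb_term n n.+1
| RbEps n : rb_term n.+1 n
| RbTau n : rb_term n.+2 n.+2.

Declare Scope rb_scope.
Delimit Scope rb_scope with rb.

Section RB.
Local Open Scope rb_scope.
Local Notation "g ∘ f" := (RbComp g f) : rb_scope.
Local Notation one := RbId.
Local Notation M := RbM.
Local Notation nabla := RbNabla.
Local Notation delta := RbDelta.
Local Notation u := RbU.
Local Notation eps := RbEps.
Local Notation tau := RbTau.

Inductive rb_eq : forall n m, rb_term n m -> rb_term n m -> Prop :=
| rb_refl n m (f : rb_term n m) : f ≡ f
| rb_sym n m (f g : rb_term n m) : f ≡ g -> g ≡ f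
| rb_trans n m (f g h : rb_term n m) : f ≡ g -> g ≡ h -> f ≡ h
| rb_congC n m k (g g' : rb_term m k) (f f' : rb_term n m) :
    g ≡ g' -> f ≡ f' -> g ∘ f ≡ g' ∘ f'
| rb_congM n m (f g : rb_term n m) : f ≡ g -> M f ≡ M g
| rb_compA n m k l (h : rb_term k l) (g : rb_term m k) (f : rb_term n m) :
    h ∘ (g ∘ f) ≡ (h ∘ g) ∘ f
| rb_comp1f n m (f : rb_term n m) : one m ∘ f ≡ f
| rb_compf1 n m (f : rb_term n m) : f ∘ one n ≡ f
| rb_M1 n : M (one n) ≡ one n.+1
| rb_MM n m k (g : rb_term m k) (f : rb_term n m) : M (g ∘ f) ≡ M g ∘ M f
| rb_nat_nabla n m (f : rb_term n m) : nabla m ∘ M (M f) ≡ M f ∘ nabla n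
| rb_nat_delta n m (f : rb_term n m) : delta m ∘ M f ≡ M (M f) ∘ delta n
| rb_nat_u n m (f : rb_term n m) : u m ∘ f ≡ M f ∘ u n
| rb_nat_eps n m (f : rb_term n m) : eps m ∘ M f ≡ f ∘ eps n
| rb_nat_tau n m (f : rb_term n m) : tau m ∘ M (M f) ≡ M (M f) ∘ tau n
| rb_nablaA n : nabla n ∘ nabla n.+1 ≡ nabla n ∘ M (nabla n)
| rb_nabla_uM n : nabla n ∘ u n.+1 ≡ one n.+1
| rb_nabla_Mu n : nabla n ∘ M (u n) ≡ one n.+1
| rb_deltaA n : delta n.+1 ∘ delta n ≡ M (delta n) ∘ delta n
| rb_epsM_delta n : eps n.+1 ∘ delta n ≡ one n.+1
| rb_Meps_delta n : M (eps n) ∘ delta n ≡ one n.+1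
| rb_tauK n : tau n ∘ tau n ≡ one n.+2
| rb_yang_baxter n :
    M (tau n) ∘ tau n.+1 ∘ M (tau n) ≡ tau n.+1 ∘ M (tau n) ∘ tau n.+1
| rb_nablaC n : nabla n ∘ tau n ≡ nabla n
| rb_deltaC n : tau n ∘ delta n ≡ delta n
| rb_tau_nabla n :
    tau n ∘ nabla n.+1 ≡ M (nabla n) ∘ tau n.+1 ∘ M (tau n)
| rb_delta_tau n :
    delta n.+1 ∘ tau n ≡ M (tau n) ∘ tau n.+1 ∘ M (delta n)
| rb_tau_u n : tau n ∘ u n.+1 ≡ M (u n)
| rb_eps_tau n : eps n.+1 ∘ tau n ≡ M (eps n)
| rb_eps_u n : eps n ∘ u n ≡ one n
| rb_eps_nabla n : eps n ∘ nabla n ≡ eps n ∘ M (eps n)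
| rb_delta_u n : delta n ∘ u n ≡ M (u n) ∘ u n
| rb_delta_nabla n :
    delta n ∘ nabla n ≡
      M (nabla n) ∘ nabla n.+2 ∘ M (tau n.+1) ∘ M (M (delta n)) ∘ delta n.+1
| rb_nabla_delta n : nabla n ∘ delta n ≡ one n.+1
where "s ≡ t" := (@rb_eq _ _ s t).

End RB.

Definition rb_presentation : presentation :=
  @Presentation nat rb_term RbId RbComp rb_eq rb_refl rb_sym rb_trans
    rb_congC rb_compA rb_comp1f rb_compf1.

Definition RB : category := quotient_category rb_presentation.

Inductive rbi_gen := Nabla | Delta | U | Eps.

Definition gsrc (th : rbi_gen) (k : nat) : nat :=
  match th with Nabla => 2 * k | Delta => k | U => 0 | Eps => k end.

Definition gtgt (th : rbi_gen) (k : nat) : nat :=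
  match th with Nabla => k | Delta => 2 * k | U => k | Eps => 0 end.

(* Raw terms with a typing judgement, rather than a family indexed by source
   and target, so that whiskering needs no casts along associativity of
   addition. [IOne n m] is _n 1_m and [IGen n th k m] is _n th^k_m. *)
Inductive rbi_raw : Type :=
| IOne of nat & nat
| IGen of nat & rbi_gen & nat & nat
| IComp of rbi_raw & rbi_raw.

Fixpoint rbi_src (f : rbi_raw) : nat :=
  match f with
  | IOne n m => n + m
  | IGen n th k m => n + gsrc th k + m
  | IComp g f => rbi_src f
  end.

Fixpoint rbi_tgt (f : rbi_raw) : nat :=
  match f with
  | IOne n m => n + m
  | IGen n th k m => n + gtgt th k + m
  | IComp g f => rbi_tgt g
  end.

Fixpoint rbi_wf (f : rbi_raw) : bool :=
  match f with
  | IComp g f => [&& rbi_wf g, rbi_wf f & rbi_tgt f == rbi_src g]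
  | _ => true
  end.

Definition rbi_typed (n m : nat) (f : rbi_raw) : bool :=
  [&& rbi_wf f, rbi_src f == n & rbi_tgt f == m].

(* _n f_m *)
Fixpoint rbi_whisker (n m : nat) (f : rbi_raw) : rbi_raw :=
  match f with
  | IOne k l => IOne (n + k) (l + m)
  | IGen k th i l => IGen (n + k) th i (l + m)
  | IComp g f => IComp (rbi_whisker n m g) (rbi_whisker n m f)
  end.

(* f + g = f_l ∘ _n g for f : n -> m and g : k -> l *)
Definition rbi_sum (f g : rbi_raw) : rbi_raw :=
  IComp (rbi_whisker 0 (rbi_tgt g) f) (rbi_whisker (rbi_src f) 0 g).

Declare Scope rbi_scope.
Delimit Scope rbi_scope with rbi.

Section RBI.
Local Notation "g ∘ f" := (IComp g f) : rbi_scope.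
Local Notation "f ⊕ g" := (rbi_sum f g)
  (at level 50, left associativity) : rbi_scope.
Local Notation one n := (IOne 0 n).
Local Notation nabla n k m := (IGen n Nabla k m).
Local Notation delta n k m := (IGen n Delta k m).
Local Notation u n k m := (IGen n U k m).
Local Notation eps n k m := (IGen n Eps k m).
Local Notation "f \: n → m" := (is_true (rbi_typed n m f))
  (at level 70, n at level 69) : rbi_scope.
Local Open Scope rbi_scope.

(* [rbi_eq n m f g]: f = g as arrow terms n -> m. Composition of terms is
   associative by convention in the mathematics; as [IComp] builds trees, this
   is an equation here. *)
Inductive rbi_eq : nat -> nat -> rbi_raw -> rbi_raw -> Prop :=
| rbi_refl n m f : f \: n → m -> rbi_eq n m f f
| rbi_sym n m f g : rbi_eq n m f g -> rbi_eq n m g f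
| rbi_trans n m f g h : rbi_eq n m f g -> rbi_eq n m g h -> rbi_eq n m f h
| rbi_congW a b n m f g :
    rbi_eq a b f g ->
    rbi_eq (n + a + m) (n + b + m) (rbi_whisker n m f) (rbi_whisker n m g)
| rbi_congC n m k g g' f f' :
    rbi_eq m k g g' -> rbi_eq n m f f' -> rbi_eq n k (g ∘ f) (g' ∘ f')
| rbi_compA n m k l h g f :
    f \: n → m -> g \: m → k -> h \: k → l ->
    rbi_eq n l (h ∘ (g ∘ f)) ((h ∘ g) ∘ f)
| rbi_compf1 n m f : f \: n → m -> rbi_eq n m (f ∘ one n) f
| rbi_comp1f n m f : f \: n → m -> rbi_eq n m (one m ∘ f) f
| rbi_one : rbi_eq 1 1 (IOne 1 0) (one 1)
(* interchange, for xi : p -> q and th : s -> t *)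
| rbi_interchange (xi th : rbi_gen) (i j r : nat) :
    let p := gsrc xi i in let q := gtgt xi i in
    let s := gsrc th j in let t := gtgt th j in
    rbi_eq (p + r + s) (q + r + t)
      (IGen (q + r) th j 0 ∘ IGen 0 xi i (r + s))
      (IGen 0 xi i (r + t) ∘ IGen (p + r) th j 0)
| rbi_nat_nabla n m f : f \: n → m ->
    rbi_eq (2 * n) m (f ∘ nabla 0 n 0) (nabla 0 m 0 ∘ (f ⊕ f))
| rbi_nat_delta n m f : f \: n → m ->
    rbi_eq n (2 * m) (delta 0 m 0 ∘ f) ((f ⊕ f) ∘ delta 0 n 0)
| rbi_nat_u n m f : f \: n → m -> rbi_eq 0 m (f ∘ u 0 n 0) (u 0 m 0)
| rbi_nat_eps n m f : f \: n → m -> rbi_eq n 0 (eps 0 m 0 ∘ f) (eps 0 n 0)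
| rbi_nabla_ku k : rbi_eq k k (nabla 0 k 0 ∘ u k k 0) (one k)
| rbi_nabla_uk k : rbi_eq k k (nabla 0 k 0 ∘ u 0 k k) (one k)
| rbi_nabla_uu k l :
    rbi_eq (k + l) (k + l) (nabla 0 (k + l) 0 ∘ (u k l 0 ⊕ u 0 k l))
      (one (k + l))
| rbi_keps_delta k : rbi_eq k k (eps k k 0 ∘ delta 0 k 0) (one k)
| rbi_epsk_delta k : rbi_eq k k (eps 0 k k ∘ delta 0 k 0) (one k)
| rbi_epseps_delta k l :
    rbi_eq (k + l) (k + l) ((eps k l 0 ⊕ eps 0 k l) ∘ delta 0 (k + l) 0)
      (one (k + l))
| rbi_u0 : rbi_eq 0 0 (u 0 0 0) (one 0)
| rbi_eps0 : rbi_eq 0 0 (eps 0 0 0) (one 0)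
| rbi_nabla_delta k : rbi_eq k k (nabla 0 k 0 ∘ delta 0 k 0) (one k).

End RBI.

Lemma rbi_typed_whisker n m a b f :
  rbi_typed a b f -> rbi_typed (n + a + m) (n + b + m) (rbi_whisker n m f).
Proof.
move=> /and3P[wf /eqP <- /eqP <-] {a b}.
have srcE g : rbi_src (rbi_whisker n m g) = n + rbi_src g + m.
  by elim: g => //= *; rewrite !addnA.
have tgtE g : rbi_tgt (rbi_whisker n m g) = n + rbi_tgt g + m.
  by elim: g => //= *; rewrite !addnA.
rewrite /rbi_typed srcE tgtE !eqxx !andbT.
elim: f wf => //= g IHg f IHf /and3P[/IHg-> /IHf-> /eqP e].
by rewrite srcE tgtE e eqxx.
Qed.

Lemma rbi_typed_comp n m k g f :
  rbi_typed m k g -> rbi_typed n m f -> rbi_typed n k (IComp g f).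
Proof.
move=> /and3P[wg /eqP sg /eqP tg] /and3P[wf /eqP sf /eqP tf].
by rewrite /rbi_typed /= wg wf sg tf sf tg !eqxx.
Qed.

Lemma rbi_typed_one n : rbi_typed n n (IOne 0 n).
Proof. by rewrite /rbi_typed /= !add0n eqxx. Qed.

Lemma rbi_typed_gen n th k m :
  rbi_typed (n + gsrc th k + m) (n + gtgt th k + m) (IGen n th k m).
Proof. by rewrite /rbi_typed /= !eqxx. Qed.

Lemma rbi_typed_sum n m k l f g :
  rbi_typed n m f -> rbi_typed k l g -> rbi_typed (n + k) (m + l) (rbi_sum f g).
Proof.
move=> ft gt; rewrite /rbi_sum.
have [_ /eqP-> _] := and3P ft; have [_ _ /eqP->] := and3P gt.
apply: (rbi_typed_comp (m := n + l)).
  by have := rbi_typed_whisker 0 l ft.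
by have := rbi_typed_whisker n 0 gt; rewrite !addn0.
Qed.

Lemma rbi_eq_typed n m f g :
  rbi_eq n m f g -> rbi_typed n m f /\ rbi_typed n m g.
Proof.
have G n1 th k m1 a b : a = n1 + gsrc th k + m1 -> b = n1 + gtgt th k + m1 ->
    rbi_typed a b (IGen n1 th k m1).
  by move=> -> ->; apply: rbi_typed_gen.
have T := rbi_typed_one.
elim=> {n m f g} //.
- by move=> n m f g _ [].
- by move=> n m f g h _ [? _] _ [].
- by move=> a b n m f g _ [? ?]; split; apply: rbi_typed_whisker.
- by move=> n m k g g' f f' _ [? ?] _ [? ?]; split; apply: rbi_typed_comp; eauto.
- by move=> n m k l h g f ? ? ?; split; do ?(apply: rbi_typed_comp; eauto).
- by move=> n m f ?; split => //; apply: rbi_typed_comp; eauto.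
- by move=> n m f ?; split => //; apply: rbi_typed_comp; eauto.
- move=> xi th i j r p q s t; split.
    by apply: (rbi_typed_comp (m := q + r + s)); apply: G;
      rewrite -/p -/q -/s -/t; rewrite ?add0n ?addn0 ?addnA.
  by apply: (rbi_typed_comp (m := p + r + t)); apply: G;
    rewrite -/p -/q -/s -/t; rewrite ?add0n ?addn0 ?addnA.
- move=> n m f ft; split.
    by apply: (rbi_typed_comp ft); apply: G; rewrite /= ?add0n ?addn0.
  apply: (rbi_typed_comp (m := 2 * m)).
    by apply: G; rewrite /= ?add0n ?addn0.
  by rewrite !mul2n -!addnn; apply: rbi_typed_sum.
- move=> n m f ft; split.
    by apply: (rbi_typed_comp _ ft); apply: G; rewrite /= ?add0n ?addn0.
  apply: (rbi_typed_comp (m := 2 * n)).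
    by rewrite !mul2n -!addnn; apply: rbi_typed_sum.
  by apply: G; rewrite /= ?add0n ?addn0.
- move=> n m f ft; split; last by apply: G; rewrite /= ?addn0.
  by apply: (rbi_typed_comp ft); apply: G; rewrite /= ?add0n ?addn0.
- move=> n m f ft; split; last by apply: G; rewrite /= ?addn0.
  by apply: (rbi_typed_comp _ ft); apply: G; rewrite /= ?add0n ?addn0.
- move=> k; split=> //; apply: (rbi_typed_comp (m := 2 * k)); apply: G;
  by rewrite /= ?mul2n -?addnn ?add0n ?addn0.
- move=> k; split=> //; apply: (rbi_typed_comp (m := 2 * k)); apply: G;
  by rewrite /= ?mul2n -?addnn ?add0n ?addn0.
- move=> k l; split=> //; apply: (rbi_typed_comp (m := 2 * (k + l))).
    by apply: G; rewrite /= ?add0n ?addn0.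
  rewrite mul2n -addnn; apply: rbi_typed_sum; apply: G;
  by rewrite /= ?add0n ?addn0.
- move=> k; split=> //; apply: (rbi_typed_comp (m := 2 * k)); apply: G;
  by rewrite /= ?mul2n -?addnn ?add0n ?addn0.
- move=> k; split=> //; apply: (rbi_typed_comp (m := 2 * k)); apply: G;
  by rewrite /= ?mul2n -?addnn ?add0n ?addn0.
- move=> k l; split=> //; apply: (rbi_typed_comp (m := 2 * (k + l))).
    rewrite mul2n -addnn; apply: rbi_typed_sum; apply: G;
    by rewrite /= ?add0n ?addn0.
  by apply: G; rewrite /= ?add0n ?addn0.
- move=> k; split=> //; apply: (rbi_typed_comp (m := 2 * k)); apply: G;
  by rewrite /= ?add0n ?addn0.
Qed.

Definition rbi_term (n m : nat) : Type := {f : rbi_raw | rbi_typed n m f}.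

Definition rbi_id (n : nat) : rbi_term n n :=
  exist _ (IOne 0 n) (rbi_typed_one n).

Definition rbi_comp (n m k : nat) (g : rbi_term m k) (f : rbi_term n m) :
    rbi_term n k :=
  exist _ (IComp (sval g) (sval f)) (rbi_typed_comp (svalP g) (svalP f)).

Program Definition rbi_presentation : presentation :=
  @Presentation nat rbi_term rbi_id rbi_comp
    (fun n m f g => rbi_eq n m (sval f) (sval g)) _ _ _ _ _ _ _.
Next Obligation. by move=> n m [f ft]; apply: rbi_refl. Qed.
Next Obligation. by move=> n m f g; apply: rbi_sym. Qed.
Next Obligation. by move=> n m f g h; apply: rbi_trans. Qed.
Next Obligation. by move=> n m k g g' f f'; apply: rbi_congC. Qed.
Next Obligation.
by move=> n m k l [h ht] [g gt] [f ft]; exact: (rbi_compA ft gt ht).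
Qed.
Next Obligation. by move=> n m [f ft]; apply: rbi_comp1f. Qed.
Next Obligation. by move=> n m [f ft]; apply: rbi_compf1. Qed.

Definition RBI : category := quotient_category rbi_presentation.

Definition relation (n m : nat) := {set 'I_n * 'I_m}.

Definition rel_id (n : nat) : relation n n := [set p | p.1 == p.2].

Definition rel_comp (n m k : nat) (R2 : relation m k) (R1 : relation n m) :
    relation n k :=
  [set p | [exists z, ((p.1, z) \in R1) && ((z, p.2) \in R2)]].

Lemma rel_compA n m k l (h : relation k l) (g : relation m k)
    (f : relation n m) : rel_comp h (rel_comp g f) = rel_comp (rel_comp h g) f.
Proof.
apply/setP => -[x y]; rewrite !inE /=; apply/existsP/existsP.
- move=> [z]; rewrite inE => /andP[/existsP[w /andP[a b]] c].
  by exists w; rewrite a inE; apply/existsP; exists z; rewrite b.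
- move=> [w]; rewrite inE => /andP[a /existsP[z /andP[b c]]].
  by exists z; rewrite c inE andbT; apply/existsP; exists w; rewrite a.
Qed.

Lemma rel_comp1f n m (f : relation n m) : rel_comp (rel_id m) f = f.
Proof.
apply/setP => -[x y]; rewrite !inE /=; apply/existsP/idP.
  by move=> [z]; rewrite inE /= => /andP[? /eqP<-].
by move=> xy; exists y; rewrite xy inE /=.
Qed.

Lemma rel_compf1 n m (f : relation n m) : rel_comp f (rel_id n) = f.
Proof.
apply/setP => -[x y]; rewrite !inE /=; apply/existsP/idP.
  by move=> [z]; rewrite inE /= => /andP[/eqP->].
by move=> xy; exists x; rewrite xy inE /= eqxx.
Qed.

Definition Rel : category :=
  @Category nat relation rel_id rel_comp rel_compA rel_comp1f rel_compf1.

(* Main.v *)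
From Corelib Require Import Setoid Morphisms.
Require Import Defs.
From mathcomp Require Import all_boot.
From mathcomp Require Import boolp zify.

(** Both syntactic categories are isomorphic to [Rel], and the third isomorphism
is their composite. In each case an arrow term denotes an operator on bit
streams, and the denotation is shown to be sound, surjective and injective
modulo the equations.

A relation [R] from [n] to [m] is the same thing as a union-preserving map from
subsets of [n] to subsets of [m]. Letting such a map act on infinite streams of
bits, by renumbering the untouched tail, removes all type dependency: whiskering
on the right does nothing, whiskering on the left is iterated [lift_op], and
composition of relations is composition of functions. The operators that arise
are those satisfying [linear]; [linear_inj] and [relation_of_comp] identify them
with relations, and [iso_Rel] turns a sound, complete and surjective denotation
into an isomorphism with [Rel].

Completeness for the relational bialgebraic monad comes from a normal form.
A relation out of [n.+1] consists of the image [c] of [0] and of a relation out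
of [n]; accordingly [nform] composes [spread m c], which sends a strand through
the other [m] strands and merges a copy of it into those selected by [c], with
the normal form of the rest. The crux is [spread_slide]: any arrow term [f] can
be pushed through a spread, replacing [c] by its image under [f]. It
reduces to one string-diagram identity for each generator ([nabla_cross],
[delta_cross], [tau_cross], [eps_cross], [cross_false]); the bialgebra equations
let a duplication pass a merging in [delta_cross]. Hence every term
equals a normal form ([nformP]), and normal forms denote different relations
unless they coincide.

Completeness for the other category uses that its equations are those of a
category with biproducts, in which every [n] is an [n]-fold sum of [1].
So an arrow is determined by its entries [1 -> 1] ([copair_ext], [pair_ext]),
and it remains to see that every entry is an identity or a zero arrow
([endo1_bit]). This holds because columns [1 -> n] whose entries are of this
kind are preserved by composition with every arrow term ([preserves_bitsP]), and
a sum of two such entries is again one of them, as merging after duplicating is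
the identity ([bit_or]). The zero arrow and the identity of [1] denote different
operators, so the denotation separates arrows. *)

Set Implicit Arguments.
Unset Strict Implicit.
Unset Printing Implicit Defensive.

(** * Isomorphisms of categories *)

Lemma functor_ext (C D : category) (o : C -> D)
    (h h' : forall a b, @hom C a b -> @hom D (o a) (o b)) p q p' q' :
  (forall a b f, h a b f = h' a b f) ->
  Functor (fobj := o) (fhom := h) p q = Functor (fhom := h') p' q'.
Proof.
move=> hh'.
have E : h = h' by apply: functional_extensionality_dep => a;
  apply: functional_extensionality_dep => b; apply: funext => f.
by case: _ / E p' q' => p' q'; congr Functor; apply: Prop_irrelevance.
Qed.

Lemma isomorphic_sym C D : isomorphic C D -> isomorphic D C.
Proof. by move=> [F [G [GF FG]]]; exists G, F. Qed.

Lemma isomorphic_trans C D E :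
  isomorphic C D -> isomorphic D E -> isomorphic C E.
Proof.
have compA (C1 C2 C3 C4 : category) (H : functor C3 C4) (G : functor C2 C3)
    (F : functor C1 C2) :
    functor_comp H (functor_comp G F) = functor_comp (functor_comp H G) F.
  exact: functor_ext.
have compf1 (C1 C2 : category) (F : functor C1 C2) :
    functor_comp F (functor_id C1) = F.
  by case: F => *; exact: functor_ext.
move=> [F [F' [F'F FF']]] [G [G' [G'G GG']]].
exists (functor_comp G F), (functor_comp F' G'); split.
  by rewrite compA -(compA _ _ _ _ F' G' G) G'G compf1.
by rewrite compA -(compA _ _ _ _ G F F') FF' compf1.
Qed.

(** * Relations as linear operators on bit streams *)

Notation stream := (nat -> bool).
Definition join (s t : stream) : stream := fun i => s i || t i.
Definition basis (i : nat) : stream := fun k => k == i.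

(** [D] acts as a union-preserving map from subsets of [n] to subsets of [m] on
the initial bits and moves the remaining bits from position [n] on to position
[m] on. *)
Record linear n m (D : stream -> stream) : Prop := Linear {
  lin_or : forall s t, D (join s t) = join (D s) (D t);
  lin_0 : D xpred0 = xpred0;
  lin_tail : forall s i, D s (m + i) = s (n + i);
  lin_local : forall s t, (forall j, j < n -> s j = t j) ->
    forall i, i < m -> D s i = D t i }.

Lemma linear_id n : linear n n id.
Proof. by split. Qed.

Lemma linear_comp n m k (D' D : stream -> stream) :
  linear m k D' -> linear n m D -> linear n k (D' \o D).
Proof.
move=> L' L; split=> [s t||s i|s t st i ik] /=.
- by rewrite (lin_or L) (lin_or L').
- by rewrite (lin_0 L) (lin_0 L').
- by rewrite (lin_tail L') (lin_tail L).
- by apply: (lin_local L') ik => j jm; apply: (lin_local L) jm.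
Qed.

Definition relation_of n m (D : stream -> stream) : relation n m :=
  [set p : 'I_n * 'I_m | D (basis p.1) p.2].

(** By locality only the first [n] bits of [s] matter, and these are a finite
join of basis vectors. *)
Lemma linear_expand n m D s j : linear n m D -> j < m ->
  D s j = [exists i : 'I_n, s i && D (basis i) j].
Proof.
move=> L jm.
have -> : D s j = D (fun k => (k < n) && s k) j.
  by apply: (lin_local L) jm => k kn; rewrite kn.
have -> : [exists i : 'I_n, s i && D (basis i) j] =
          has (fun i => s i && D (basis i) j) (iota 0 n).
  apply/existsP/hasP => [[i ij]|[i]].
    by exists (val i); rewrite ?mem_iota ?ltn_ord.
  by rewrite mem_iota => /= ilt ij; exists (Ordinal ilt).
elim: (n) => [|k IHk]; first exact: (congr1 (@^~ j) (lin_0 L)).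
rewrite -addn1 iotaD has_cat /= add0n orbF -IHk.
(* One more bit joins at most one more basis vector. *)
have -> : (fun i => (i < k + 1) && s i) =
    join (fun i => (i < k) && s i) (if s k then basis k else xpred0).
  apply: funext => i; rewrite /join addn1 ltnS leq_eqVlt orbC andb_orl.
  congr (_ || _); have [->|ik] := eqVneq i k.
    by case: (s k); rewrite /basis ?eqxx.
  by case: (s k); rewrite /basis ?(negPf ik).
by rewrite (lin_or L) /join; case: (s k); rewrite //= (lin_0 L).
Qed.

Lemma linear_inj n m D D' : linear n m D -> linear n m D' ->
  relation_of n m D = relation_of n m D' -> D = D'.
Proof.
move=> L L' DD'; apply: funext => s; apply: funext => j.
have [jm|mj] := ltnP j m; last first.
  by rewrite -(subnKC mj) (lin_tail L) (lin_tail L').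
rewrite (linear_expand _ L jm) (linear_expand _ L' jm).
apply: eq_existsb => i.
by have /setP/(_ (i, Ordinal jm)) := DD'; rewrite !inE /= => ->.
Qed.

Lemma relation_of_id n : relation_of n n id = rel_id n.
Proof. by apply/setP => p; rewrite !inE /basis eq_sym. Qed.

Lemma relation_of_comp n m k D' D : linear m k D' -> linear n m D ->
  relation_of n k (D' \o D) = rel_comp (relation_of m k D') (relation_of n m D).
Proof.
move=> L' L; apply/setP => -[x y]; rewrite !inE /= (linear_expand _ L') //.
by apply: eq_existsb => z; rewrite !inE.
Qed.

(** A denotation of arrow terms that identifies exactly the equal ones and
reaches every relation induces a functor that is the identity on objects and
bijective on arrows, so its inverse is a functor too. *)
Lemma iso_Rel (T : nat -> nat -> Type) one comp eqv
    refl sym trans congr assoc unitl unitr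
    (P := @Presentation nat T one comp eqv refl sym trans congr assoc
       unitl unitr)
    (den : forall n m, T n m -> stream -> stream) :
  (forall n, den _ _ (one n) = id) ->
  (forall n m k (g : T m k) (f : T n m),
     den _ _ (comp _ _ _ g f) = den _ _ g \o den _ _ f) ->
  (forall n m f, linear n m (den n m f)) ->
  (forall n m f g, eqv n m f g <-> den _ _ f = den _ _ g) ->
  (forall n m R, exists f : T n m, relation_of n m (den _ _ f) = R) ->
  isomorphic (quotient_category P) Rel.
Proof.
move=> den1 denM denL denE denS.
pose C := quotient_category P.
pose F (n m : nat) (q : @hom C n m) : relation n m :=
  relation_of n m (den _ _ (qrepr q)).
have FE n m (f : T n m) : F n m (@qclass P n m f) = relation_of n m (den _ _ f).
  rewrite /F; congr relation_of; apply/denE.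
  by apply/(@qclassP P); rewrite qreprK.
have F1 (n : nat) : F n n (@Defs.cid C n) = rel_id n.
  by rewrite /= FE den1 relation_of_id.
have FM (n m k : nat) (g : @hom C m k) (f : @hom C n m) :
    F n k (ccomp g f) = rel_comp (F m k g) (F n m f).
  by rewrite /= FE denM (relation_of_comp (denL _ _ _) (denL _ _ _)).
have Finj (n m : nat) (f g : @hom C n m) : F n m f = F n m g -> f = g.
  move=> fg; rewrite -[f](@qreprK P) -[g](@qreprK P); apply/(@qclassP P)/denE.
  by apply: linear_inj fg.
have Fsurj (n m : nat) (R : relation n m) : {f : @hom C n m | F n m f = R}.
  apply: boolp.cid; have [f fR] := denS n m R.
  by exists (@qclass P n m f); rewrite FE.
pose G n m (R : relation n m) : @hom C n m := sval (Fsurj n m R).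
have FG n m R : F n m (G n m R) = R := svalP (Fsurj n m R).
have GF n m f : G n m (F n m f) = f by apply: Finj; rewrite FG.
pose FF : functor C Rel := @Functor C Rel id F F1 FM.
have G1 (n : nat) : G n n (rel_id n) = @Defs.cid C n by rewrite -F1 GF.
have GM n m k (S : relation m k) (R : relation n m) :
    G n k (rel_comp S R) = ccomp (G m k S) (G n m R).
  by apply: Finj; rewrite FM !FG.
pose GG : functor Rel C := @Functor Rel C id G G1 GM.
by exists FF, GG; split; apply: functor_ext.
Qed.

(** The effect on streams of adding an idle strand before all others. *)
Definition lift_op (D : stream -> stream) : stream -> stream :=
  fun s i => if i is j.+1 then D (s \o succn) j else s 0.

Lemma linear_lift_op n m D : linear n m D -> linear n.+1 m.+1 (lift_op D).
Proof.
move=> L; split=> [s t||s i|s t st [|i] im] /=.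
- apply: funext => -[|i] //=.
  exact: (congr1 (@^~ i) (lin_or L (s \o succn) (t \o succn))).
- by apply: funext => -[|i] //=; rewrite [_ \o _](_ : _ = xpred0) // (lin_0 L).
- exact: (lin_tail L).
- exact: st.
- by apply: (lin_local L) => // j jn; apply: st.
Qed.

(** Idle strands after all others come for free, since linear operators already
carry the tail of a stream along. *)
Lemma linear_widen k n m D : linear n m D -> linear (n + k) (m + k) D.
Proof.
move=> L; split=> [s t||s i|s t st i im].
- exact: (lin_or L).
- exact: (lin_0 L).
- by rewrite -!addnA (lin_tail L).
- have [lim|mi] := ltnP i m.
    by apply: (lin_local L) lim => j jn; apply: st; rewrite ltn_addr.
  rewrite -(subnKC mi) !(lin_tail L); apply: st.
  by rewrite ltn_add2l -(ltn_add2l m) subnKC.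
Qed.

(** Besides interpreting the generators of the second category, these operators
for [k = 1] interpret the components of the monad. *)
Definition gen_op (th : rbi_gen) k (s : stream) : stream :=
  match th with
  | Nabla => fun i => if i < k then s i || s (k + i) else s (k + i)
  | Delta => fun i => if i < k then s i else s (i - k)
  | U => fun i => if i < k then false else s (i - k)
  | Eps => fun i => s (k + i)
  end.

Lemma linear_gen th k : linear (gsrc th k) (gtgt th k) (gen_op th k).
Proof.
case: th; split=> /= [s t||s i|s t st i ik].
- by apply: funext => i; rewrite /join; case: ifP => // _; rewrite orbACA.
- by apply: funext => i; case: ifP.
- by rewrite ltnNge leq_addr /= addnA mul2n addnn.
- by rewrite ik !st // mul2n -addnn ?ltn_add2l // ltn_addr.
- by apply: funext => i; rewrite /join; case: ifP.
- by apply: funext => i; case: ifP.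
- by rewrite mul2n -addnn -addnA ltnNge leq_addr /= addKn.
- by case: ltnP => [/st//|ki]; apply: st; rewrite ltn_subLR // addnn -mul2n.
- by apply: funext => i; rewrite /join; case: ifP.
- by apply: funext => i; case: ifP.
- by rewrite ltnNge leq_addr /= addKn add0n.
- by rewrite ik.
- by [].
- by [].
- by [].
- by [].
Qed.

Lemma big_orb_basis n (c : nat -> bool) i :
  i < n -> \big[orb/false]_(k < n) (basis i k && c k) = c i.
Proof.
move=> ilt; rewrite (bigD1 (Ordinal ilt)) //= /basis eqxx big1 ?orbF //.
by move=> k; rewrite -val_eqE /= => /negPf->.
Qed.

Definition rel_matrix n m (R : relation n m) : nat -> nat -> bool :=
  fun i j => [exists p in R, (val p.1 == i) && (val p.2 == j)].

Lemma rel_matrixE n m (R : relation n m) (p : 'I_n * 'I_m) :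
  rel_matrix R p.1 p.2 = (p \in R).
Proof.
case: p => x y; apply/exists_inP/idP => [[[i j] ij]|xy] /=.
  by move=> /andP[/eqP/val_inj <- /eqP/val_inj <-].
by exists (x, y); rewrite ?eqxx.
Qed.

(** The form in which both constructions of a term with prescribed matrix
deliver its denotation. *)
Lemma relation_of_matrix n m (R : relation n m) (D : stream -> stream) :
  (forall s j, j < m ->
     D s j = \big[orb/false]_(i < n) (s i && rel_matrix R i j)) ->
  relation_of n m D = R.
Proof.
move=> DE; apply/setP => p; rewrite !inE DE //.
rewrite (big_orb_basis (rel_matrix R ^~ p.2)) //.
exact: rel_matrixE.
Qed.

(** * Arrow terms of the free relational bialgebraic monad *)

Section MonadTerms.
Local Notation "s ≡ t" := (rb_eq s t).
Local Notation "g ∘ f" := (RbComp g f).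

#[local] Instance rb_eq_Equivalence n m : Equivalence (@rb_eq n m).
Proof.
split; [exact: @rb_refl | exact: @rb_sym | exact: @rb_trans].
Qed.

#[local] Hint Resolve rb_refl : core.

#[local] Instance RbComp_Proper n m k :
  Proper (@rb_eq m k ==> @rb_eq n m ==> @rb_eq n k) (@RbComp n m k).
Proof. by move=> g g' gg' f f' ff'; apply: rb_congC. Qed.

#[local] Instance RbM_Proper n m :
  Proper (@rb_eq n m ==> @rb_eq n.+1 m.+1) (@RbM n m).
Proof. by move=> f g; apply: rb_congM. Qed.

(** Diagrams are kept as right-nested composites; this applies an equation
between two-fold composites in the middle of one. *)
Lemma rb_slide n m k l (g : rb_term k l) (f : rb_term m k) (r : rb_term m l)
    (h : rb_term n m) : g ∘ f ≡ r -> g ∘ (f ∘ h) ≡ r ∘ h.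
Proof. by move=> e; rewrite -e rb_compA. Qed.

Lemma rb_liftM n m k (g : rb_term m k) (f : rb_term n m) (r : rb_term n k) :
  g ∘ f ≡ r -> RbM g ∘ RbM f ≡ RbM r.
Proof. by move=> e; rewrite -e rb_MM. Qed.

Ltac rb_norm := rewrite ?rb_MM -?rb_compA.

Lemma rb_tau_Mu n : RbTau n ∘ RbM (RbU n) ≡ RbU n.+1.
Proof. by rewrite -rb_tau_u rb_compA rb_tauK rb_comp1f. Qed.

Lemma rb_tau_Mnabla n :
  RbTau n ∘ RbM (RbNabla n) ≡ RbNabla n.+1 ∘ (RbM (RbTau n) ∘ RbTau n.+1).
Proof.
(* Compose the slide of tau past nabla with symmetries on both sides. *)
have /(rb_congC (rb_refl (RbTau n))) /rb_sym := rb_tau_nabla n.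
move=> /(rb_congC)/(_ (rb_refl (RbM (RbTau n) ∘ RbTau n.+1))).
rb_norm; rewrite (rb_slide _ (rb_tauK _)) rb_comp1f => e; rewrite -e.
rewrite (rb_slide _ (rb_liftM (rb_tauK _))) rb_M1 rb_comp1f.
by rewrite rb_tauK rb_compf1.
Qed.

(** From a strand [x] produce the pair [(x, x)] or [(0, x)], according to [b].
Treating comultiplication and unit uniformly halves the diagrams below. *)
Definition branch b n : rb_term n.+1 n.+2 := if b then RbDelta n else RbU n.+1.

Lemma branch_nat b n m (f : rb_term n m) :
  branch b m ∘ RbM f ≡ RbM (RbM f) ∘ branch b n.
Proof. by case: b; [apply: rb_nat_delta | apply: rb_nat_u]. Qed.

Lemma branch_tau b n :
  branch b n.+1 ∘ RbTau n ≡ RbM (RbTau n) ∘ (RbTau n.+1 ∘ RbM (branch b n)).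
Proof.
case: b => /=; first by rewrite rb_delta_tau -rb_compA.
by rewrite rb_tau_Mu rb_nat_u.
Qed.

Lemma Mbranch_tau b n :
  RbM (branch b n) ∘ RbTau n ≡ RbTau n.+1 ∘ (RbM (RbTau n) ∘ branch b n.+1).
Proof.
transitivity
  (RbTau n.+1 ∘ (RbM (RbTau n) ∘ (branch b n.+1 ∘ (RbTau n ∘ RbTau n)))).
  rewrite (rb_slide _ (branch_tau b n)); rb_norm.
  rewrite (rb_slide _ (rb_liftM (rb_tauK _))) rb_M1 rb_comp1f.
  by rewrite (rb_slide _ (rb_tauK _)) rb_comp1f.
by rewrite rb_tauK rb_compf1.
Qed.

Lemma branch_swap b1 b2 n :
  RbTau n.+1 ∘ (RbM (branch b1 n) ∘ branch b2 n) ≡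
  RbM (branch b2 n) ∘ branch b1 n.
Proof.
case: b1 b2 => [] [] /=.
- by rewrite -rb_deltaA (rb_slide _ (rb_deltaC _)).
- by rewrite -rb_nat_u (rb_slide _ (rb_tau_u _)).
- by rewrite (rb_slide _ (rb_tau_Mu _)) rb_nat_u.
- by rewrite (rb_slide _ (rb_tau_Mu _)) rb_nat_u.
Qed.

Lemma nabla_branch_branch b1 b2 n :
  RbNabla n.+1 ∘ (RbM (branch b2 n) ∘ branch b1 n) ≡ branch (b1 || b2) n.
Proof.
case: b1 b2 => [] [] /=.
- by rewrite -rb_deltaA (rb_slide _ (rb_nabla_delta _)) rb_comp1f.
- by rewrite (rb_slide _ (rb_nabla_Mu _)) rb_comp1f.
- by rewrite -rb_nat_u (rb_slide _ (rb_nabla_uM _)) rb_comp1f.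
- by rewrite (rb_slide _ (rb_nabla_Mu _)) rb_comp1f.
Qed.

Lemma delta_branch b n :
  RbDelta n.+1 ∘ branch b n ≡ RbM (branch b n) ∘ branch b n.
Proof. by case: b => /=; [apply: rb_deltaA | apply: rb_delta_u]. Qed.

Lemma eps_branch b n : RbEps n.+1 ∘ branch b n ≡ RbId n.+1.
Proof. by case: b => /=; [apply: rb_epsM_delta | apply: rb_eps_u]. Qed.

(** Sends [(x, y)] to [(y + b x, x)]: the strand [x] passes [y] and leaves a
copy of itself there when [b] holds. It is locked because rewriting with
associativity would otherwise look inside it. *)
Definition cross b n : rb_term n.+2 n.+2 :=
  locked (RbNabla n.+1 ∘ (RbM (RbTau n) ∘ branch b n.+1)).

Lemma cross_nat b n m (f : rb_term n m) :
  cross b m ∘ RbM (RbM f) ≡ RbM (RbM f) ∘ cross b n.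
Proof.
rewrite /cross -!lock; rb_norm; rewrite branch_nat.
rewrite (rb_slide _ (rb_liftM (rb_nat_tau f))); rb_norm.
by rewrite (rb_slide _ (rb_nat_nabla _)); rb_norm.
Qed.

(** Two successive crossings, with both branchings moved to the start and both
mergings to the end. The three diagrams that follow are compared in this form,
where they reduce to a permutation of strands and to one property of [branch]:
[nabla_branch_branch], [delta_branch] or [branch_swap]. *)
Lemma cross_cross b1 b2 n :
  RbM (cross b2 n) ∘ cross b1 n.+1 ≡
  RbM (RbNabla n.+1) ∘ (RbNabla n.+3 ∘ (RbM (RbM (RbM (RbTau n))) ∘
   (RbM (RbTau n.+2) ∘ (RbM (RbM (RbTau n.+1)) ∘
    (RbM (branch b2 n.+2) ∘ branch b1 n.+2))))).
Proof.
rewrite /cross -!lock; rb_norm.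
rewrite (rb_slide _ (rb_sym (rb_nat_nabla (branch b2 n.+1)))); rb_norm.
rewrite (rb_slide _ (rb_sym (rb_nat_nabla (RbM (RbTau n))))); rb_norm.
by rewrite (rb_slide _ (rb_liftM (Mbranch_tau b2 n.+1))); rb_norm.
Qed.

Lemma eps_cross b n : RbEps n.+1 ∘ cross b n ≡ RbM (RbEps n).
Proof.
rewrite /cross -!lock (rb_slide _ (rb_eps_nabla _)); rb_norm.
rewrite (rb_slide _ (rb_liftM (rb_eps_tau n))).
by rewrite -branch_nat (rb_slide _ (eps_branch _ _)) rb_comp1f.
Qed.

Lemma cross_false n : cross false n ≡ RbTau n.
Proof.
rewrite /cross -!lock /= -rb_nat_u (rb_slide _ (rb_nabla_uM _)).
by rewrite rb_comp1f.
Qed.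

Lemma cross_Mu n : cross true n ∘ RbM (RbU n) ≡ RbDelta n.
Proof.
rewrite /cross -!lock -!rb_compA branch_nat /=.
rewrite (rb_slide _ (rb_liftM (rb_tau_Mu n))).
by rewrite (rb_slide _ (rb_nabla_Mu _)) rb_comp1f.
Qed.

(** Both sides send [(x, y, z)] to [(y + z + (b1 || b2) x, x)]. *)
Lemma nabla_cross b1 b2 n :
  RbNabla n.+1 ∘ (RbM (cross b2 n) ∘ cross b1 n.+1) ≡
  cross (b1 || b2) n ∘ RbM (RbNabla n).
Proof.
rewrite cross_cross.
rewrite (rb_slide _ (rb_sym (rb_nablaA _))); rb_norm.
rewrite (rb_slide _ (rb_liftM (rb_sym (rb_nat_tau (RbTau n))))); rb_norm.
rewrite (rb_slide _ (rb_nablaA n.+2)); rb_norm.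
rewrite (rb_slide _ (rb_liftM (rb_nablaC _))).
rewrite (rb_slide _ (rb_sym (rb_nablaA n.+2))); rb_norm.
rewrite (rb_slide _ (rb_nat_nabla (RbM (RbTau n)))); rb_norm.
rewrite (rb_slide _ (rb_nat_nabla (RbTau n.+1))); rb_norm.
rewrite nabla_branch_branch /cross -!lock; rb_norm.
rewrite branch_nat (rb_slide _ (rb_liftM (rb_tau_Mnabla n))); rb_norm.
by rewrite (rb_slide _ (rb_sym (rb_nablaA _))); rb_norm.
Qed.

(** Both sides send [(x, y)] to [(y + b x, y + b x, x)]; on the left the sum is
formed before being duplicated, whence the bialgebra equation. *)
Lemma delta_cross b n :
  RbDelta n.+1 ∘ cross b n ≡ RbM (cross b n) ∘ (cross b n.+1 ∘ RbM (RbDelta n)).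
Proof.
rewrite (rb_compA (RbM _)) cross_cross /cross -!lock; rb_norm.
rewrite (rb_slide _ (rb_delta_nabla _)); rb_norm.
rewrite (rb_slide _ (rb_nat_delta (RbTau n))); rb_norm.
rewrite (rb_slide _ (rb_liftM (rb_liftM (rb_delta_tau n)))); rb_norm.
rewrite delta_branch branch_nat.
rewrite (rb_slide _ (rb_liftM (branch_nat b (RbDelta n)))); rb_norm.
by rewrite (rb_slide _ (rb_liftM (rb_sym (rb_nat_tau (RbTau n))))); rb_norm.
Qed.

(** Both sides send [(x, y, z)] to [(z + b2 x, y + b1 x, x)]. After sliding the
symmetries through the mergings and branchings, two permutations of five strands
are left, which agree by the Yang-Baxter equation. *)
Lemma tau_cross b1 b2 n :
  RbTau n.+1 ∘ (RbM (cross b2 n) ∘ cross b1 n.+1) ≡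
  RbM (cross b1 n) ∘ (cross b2 n.+1 ∘ RbM (RbTau n)).
Proof.
rewrite (rb_compA (RbM (cross b1 n))) !cross_cross; rb_norm.
rewrite (rb_slide _ (rb_tau_Mnabla _)); rb_norm.
rewrite (rb_slide _ (rb_tau_nabla _)); rb_norm.
rewrite (rb_slide _ (rb_liftM (rb_tau_nabla n.+1))); rb_norm.
rewrite (rb_slide _ (rb_nat_nabla (RbNabla n.+1))); rb_norm.
rewrite (rb_slide _ (rb_liftM (rb_sym (rb_nat_tau (RbTau n))))); rb_norm.
rewrite (rb_slide _ (rb_liftM (rb_tauK n.+2))) rb_M1 rb_comp1f.
rewrite branch_nat (rb_slide _ (rb_liftM (branch_nat b1 (RbTau n)))); rb_norm.
rewrite -(branch_swap b1 b2).
rewrite (rb_slide _ (rb_sym (rb_nat_tau (RbTau n.+1)))); rb_norm.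
rewrite (rb_slide _ (rb_sym (rb_nat_tau (RbTau n.+1)))); rb_norm.
rewrite (rb_slide _ (rb_sym (rb_nat_tau (RbM (RbTau n))))); rb_norm.
rewrite (rb_slide _ (rb_sym (rb_nat_tau (RbTau n.+1)))); rb_norm.
rewrite (rb_slide _ (rb_tauK _)) rb_comp1f.
rewrite (rb_slide _ (rb_liftM (rb_sym (rb_nat_tau (RbTau n))))); rb_norm.
have := rb_congM (rb_congM (rb_yang_baxter n)); rb_norm => yb.
do 3 (apply: rb_congC; first by []).
have := rb_congC yb (rb_refl (RbM (branch b1 n.+2) ∘ branch b2 n.+2)).
by rb_norm => e; rewrite e.
Qed.


Definition row_cons b (c : nat -> bool) : nat -> bool :=
  fun i => if i is i'.+1 then c i' else b.

(** The strand [0] of [m.+1] strands is merged into the strands selected by [c]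
among the other [m] and then discarded. *)
Fixpoint spread m (c : nat -> bool) : rb_term m.+1 m :=
  match m with
  | 0 => RbEps 0
  | m'.+1 => RbM (spread m' (c \o succn)) ∘ cross (c 0) m'
  end.

Lemma spreadS b m c :
  spread m.+1 (row_cons b c) = RbM (spread m c) ∘ cross b m.
Proof. by []. Qed.

(** The new column [c'] is the image of [c] under the relation denoted by
[f]. *)
Lemma spread_slide n m (f : rb_term n m) c :
  exists c', f ∘ spread n c ≡ spread m c' ∘ RbM f.
Proof.
elim: f c => {n m} [n|n m k g IHg f IHf|n m f IHf|n|n|n|n|n] c.
- by exists c; rewrite rb_M1 rb_comp1f rb_compf1.
- have [c' ec'] := IHf c; have [c'' ec''] := IHg c'; exists c''.
  by rewrite -rb_compA ec' (rb_slide _ ec''); rb_norm.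
- have [c' ec'] := IHf (c \o succn); exists (row_cons (c 0) c').
  rewrite spreadS /= (rb_slide _ (rb_liftM ec')) ; rb_norm.
  by rewrite cross_nat.
- exists (row_cons (c 0 || c 1) (c \o succn \o succn)).
  rewrite spreadS /=; rb_norm.
  by rewrite (rb_slide _ (rb_nat_nabla _)) -rb_compA nabla_cross.
- exists (row_cons (c 0) (row_cons (c 0) (c \o succn))).
  rewrite !spreadS /=; rb_norm.
  by rewrite (rb_slide _ (rb_nat_delta _)) -rb_compA delta_cross.
- exists (row_cons false c); rewrite spreadS /= rb_nat_u -rb_compA.
  by rewrite cross_false rb_tau_Mu.
- exists (c \o succn); rewrite /= (rb_slide _ (rb_nat_eps _)) -rb_compA.
  by rewrite eps_cross.
- exists (row_cons (c 1) (row_cons (c 0) (c \o succn \o succn))).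
  rewrite !spreadS /=; rb_norm.
  by rewrite (rb_slide _ (rb_nat_tau _)) -rb_compA tau_cross.
Qed.

(** The only arrow from [0], up to equality, by the next lemma. *)
Fixpoint units m : rb_term 0 m :=
  if m is m'.+1 then RbU m' ∘ units m' else RbId 0.

Lemma units_slide n m (f : rb_term n m) : f ∘ units n ≡ units m.
Proof.
elim: f => {n m} [n|n m k g IHg f IHf|n m f IHf|n|n|n|n|n] /=.
- by rewrite rb_comp1f.
- by rewrite -rb_compA IHf.
- by rewrite (rb_slide _ (rb_sym (rb_nat_u f))) -rb_compA IHf.
- by rewrite (rb_slide _ (rb_nabla_uM _)) rb_comp1f.
- by rewrite (rb_slide _ (rb_delta_u _)) -rb_nat_u -rb_compA.
- by [].
- by rewrite (rb_slide _ (rb_eps_u _)) rb_comp1f.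
- rewrite (rb_slide _ (rb_tau_u _)) (rb_slide _ (rb_sym (rb_nat_u _))).
  by rewrite -rb_compA.
Qed.

(** The normal form with matrix [R]: its column of index [0] is spread over the
normal form of the remaining columns. *)
Fixpoint nform n m (R : nat -> nat -> bool) : rb_term n m :=
  match n with
  | 0 => units m
  | n'.+1 => spread m (R 0) ∘ RbM (nform n' m (R \o succn))
  end.

(** Column by column, [f] is pushed through the spreads by [spread_slide] and
finally absorbed by the units. *)
Lemma nform_slide n m k (f : rb_term m k) R :
  exists R', f ∘ nform n m R ≡ nform n k R'.
Proof.
elim: n R => [|n IHn] R; first by exists R; apply: units_slide.
have [c' ec'] := spread_slide f (R 0); have [R' eR'] := IHn (R \o succn).
exists (fun i => if i is i'.+1 then R' i' else c') => /=.
by rewrite (rb_slide _ ec') -rb_compA (rb_liftM eR').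
Qed.

Lemma spread0 m : spread m xpred0 ≡ RbEps m.
Proof.
elim: m => [|m IHm] //=; rewrite [xpred0 \o _](_ : _ = xpred0) // IHm.
by rewrite cross_false -rb_eps_tau -rb_compA rb_tauK rb_compf1.
Qed.

Lemma spread_Mu m :
  spread m.+1 (row_cons true xpred0) ∘ RbM (RbU m) ≡ RbId m.+1.
Proof.
by rewrite spreadS -rb_compA cross_Mu spread0 rb_Meps_delta.
Qed.

(** The identity of [n.+1] spreads its first strand over position [0] only; the
identity of [n], followed by a unit that makes room for this position, has a
normal form by [nform_slide]. *)
Lemma nform_id n : exists R, RbId n ≡ nform n n R.
Proof.
elim: n => [|n [R eR]]; first by exists (fun _ => xpred0).
have [R' eR'] := nform_slide n (RbU n) R.
exists (fun i => if i is i'.+1 then R' i' else row_cons true xpred0).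
rewrite -[nform _ _ _]/(spread n.+1 (row_cons true xpred0) ∘
                        RbM (nform n n.+1 R')).
rewrite -(rb_liftM eR').
by rewrite rb_compA spread_Mu rb_comp1f -eR rb_M1.
Qed.

Lemma nformP n m (f : rb_term n m) : exists R, f ≡ nform n m R.
Proof.
have [R eR] := nform_id n; have [R' eR'] := nform_slide n f R.
by exists R'; rewrite -eR' -eR rb_compf1.
Qed.

(** * Denotation of terms of the monad *)

Definition swap_op (s : stream) : stream :=
  fun i => match i with 0 => s 1 | 1 => s 0 | _ => s i end.

Fixpoint rb_den n m (f : rb_term n m) : stream -> stream :=
  match f with
  | RbId _ => id
  | RbComp _ _ _ g f => rb_den g \o rb_den f
  | RbM _ _ f => lift_op (rb_den f)
  | RbNabla _ => gen_op Nabla 1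
  | RbDelta _ => gen_op Delta 1
  | RbU _ => gen_op U 1
  | RbEps _ => gen_op Eps 1
  | RbTau _ => swap_op
  end.

Lemma linear_rb_den n m (f : rb_term n m) : linear n m (rb_den f).
Proof.
have gen th k := linear_widen k (linear_gen th 1).
elim: f => {n m} /= [n|n m k g Lg f Lf|n m f Lf|n|n|n|n|n].
- exact: linear_id.
- exact: linear_comp Lg Lf.
- exact: linear_lift_op.
- exact: (gen Nabla).
- exact: (gen Delta).
- exact: (gen U).
- exact: (gen Eps).
- split=> [s t||//|s t st [|[|i]] im]; try by apply: funext => -[|[|i]].
  + exact: (st 1).
  + exact: (st 0).
  + exact: st.
Qed.

Lemma rb_den_sound n m (f g : rb_term n m) : f ≡ g -> rb_den f = rb_den g.
Proof.
elim=> {n m f g} //=.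
- by move=> n m f g h _ -> _ ->.
- by move=> n m k g g' f f' _ -> _ ->.
- by move=> n m f g _ ->.
all: try by move=> *; apply: funext => s; apply: funext => -[|[|[|[|i]]]] //=;
  rewrite ?subn1 ?orbF ?orbb ?orbA //= orbC.
move=> n m f; apply: funext => s; apply: funext => -[|i] //=.
rewrite subn1 /=; congr (rb_den f _ _).
by apply: funext => j /=; rewrite subn1.
Qed.

Lemma rb_den_cross b n s :
  rb_den (cross b n) s =
  fun i => match i with 0 => s 1 || b && s 0 | 1 => s 0 | _ => s i end.
Proof.
rewrite /cross -lock; apply: funext => -[|[|i]]; case: b => //=.
- by rewrite orbC.
- by rewrite orbF.
Qed.

Lemma rb_den_spread m c s i :
  i < m -> rb_den (spread m c) s i = s i.+1 || c i && s 0.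
Proof.
by elim: m c s i => // m IHm c s [|i] im /=; rewrite rb_den_cross ?IHm.
Qed.

Lemma rb_den_nform n m R s j : j < m ->
  rb_den (nform n m R) s j = \big[orb/false]_(i < n) (s i && R i j).
Proof.
move=> jm; elim: n R s => [|n IHn] R s /=.
  by rewrite big_ord0; elim: m j jm => // m IHm [|j] jm //=; rewrite subn1 IHm.
by rewrite rb_den_spread //= IHn big_ord_recl orbC andbC.
Qed.

Lemma spread_ext m c c' :
  (forall i, i < m -> c i = c' i) -> spread m c = spread m c'.
Proof.
elim: m c c' => //= m IHm c c' cc'; rewrite cc' // (IHm _ (c' \o succn)) //.
by move=> i im; apply: cc'.
Qed.

Lemma nform_ext n m R R' :
  (forall i j, i < n -> j < m -> R i j = R' i j) -> nform n m R = nform n m R'.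
Proof.
elim: n R R' => //= n IHn R R' RR'; rewrite (IHn _ (R' \o succn)).
  by rewrite (spread_ext (c' := R' 0)) // => j jm; apply: RR'.
by move=> i j im jm; apply: RR'.
Qed.

(** Equal denotations force the matrices of the two normal forms to agree on
their relevant entries. *)
Lemma rb_complete n m (f g : rb_term n m) : rb_den f = rb_den g -> f ≡ g.
Proof.
have [R eR] := nformP f; have [R' eR'] := nformP g.
rewrite (rb_den_sound eR) (rb_den_sound eR') => e.
rewrite eR eR' (nform_ext (R' := R')) // => i j ilt jm.
have := congr1 (fun D => D (basis i) j) e.
by rewrite !rb_den_nform // !(big_orb_basis (R^~ j), big_orb_basis (R'^~ j)).
Qed.

Lemma RB_Rel : isomorphic RB Rel.
Proof.
apply: (@iso_Rel rb_term _ _ _ _ _ _ _ _ _ _ (@rb_den)) => //.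
- exact: linear_rb_den.
- by move=> n m f g; split; [apply: rb_den_sound | apply: rb_complete].
- move=> n m R; exists (nform n m (rel_matrix R)).
  by apply: (@relation_of_matrix n m R) => s j jm; rewrite rb_den_nform.
Qed.

End MonadTerms.

(** * Arrow terms of the syntactic biproduct category *)

Section BiproductTerms.
Local Notation "g ∘ f" := (IComp g f).

(** Equality of arrow terms extended to a congruence on all raw terms, where
ill-typed terms are compared through their source and target only. It makes
rewriting possible without typing side conditions, and on typed terms it is the
equality of arrows, by [raw_eqP]. *)
Definition raw_eq (f g : rbi_raw) : Prop :=
  [/\ rbi_src f = rbi_src g, rbi_tgt f = rbi_tgt g, rbi_wf f = rbi_wf g &
      rbi_wf f -> rbi_eq (rbi_src f) (rbi_tgt f) f g].

Local Notation "f ≈ g" := (raw_eq f g) (at level 70, no associativity).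

Lemma rbi_typedP n m f :
  rbi_typed n m f <-> [/\ rbi_wf f, rbi_src f = n & rbi_tgt f = m].
Proof.
split=> [/and3P[? /eqP ? /eqP ?] //|[wf <- <-]].
by rewrite /rbi_typed wf !eqxx.
Qed.

Lemma raw_eqP n m f g : rbi_typed n m f -> f ≈ g <-> rbi_eq n m f g.
Proof.
move=> /rbi_typedP[wf sf tf]; split=> [[_ _ _ /(_ wf)]|fg].
  by rewrite sf tf.
have [_ /rbi_typedP[wg sg tg]] := rbi_eq_typed fg.
by split; rewrite ?sf ?tf ?wf.
Qed.

Lemma raw_eq_of_rbi_eq n m f g : rbi_eq n m f g -> f ≈ g.
Proof. by move=> fg; have [ft _] := rbi_eq_typed fg; apply/(raw_eqP _ ft). Qed.

Lemma raw_eq_refl f : f ≈ f.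
Proof.
by split=> // wf; apply: rbi_refl; apply/rbi_typedP.
Qed.

#[local] Hint Resolve raw_eq_refl : core.

#[local] Instance raw_eq_Equivalence : Equivalence raw_eq.
Proof.
split=> [f|f g [s t w fg]|f g h [s t w fg] [s' t' w' gh]] //.
  by split=> //; rewrite -w => /fg; rewrite s t => /rbi_sym.
split; [exact: etrans s s' | exact: etrans t t' | exact: etrans w w' |].
move=> wf; apply: rbi_trans (fg wf) _.
by rewrite s t; apply: gh; rewrite -w.
Qed.

#[local] Instance IComp_Proper : Proper (raw_eq ==> raw_eq ==> raw_eq) IComp.
Proof.
move=> g g' [sg tg wg gg'] f f' [sf tf wf ff']; split=> //=.
  by rewrite wg wf sg tf.
move=> /and3P[/gg' {}gg' /ff' {}ff' /eqP e].
by apply: rbi_congC gg' _; rewrite -e.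
Qed.

Lemma src_whisker n m f : rbi_src (rbi_whisker n m f) = n + rbi_src f + m.
Proof. by elim: f => //= *; rewrite !addnA. Qed.

Lemma tgt_whisker n m f : rbi_tgt (rbi_whisker n m f) = n + rbi_tgt f + m.
Proof. by elim: f => //= *; rewrite !addnA. Qed.

Lemma wf_whisker n m f : rbi_wf (rbi_whisker n m f) = rbi_wf f.
Proof.
elim: f => //= g -> f ->; rewrite src_whisker tgt_whisker.
by rewrite eqn_add2r eqn_add2l.
Qed.

#[local] Instance whisker_Proper n m :
  Proper (raw_eq ==> raw_eq) (rbi_whisker n m).
Proof.
move=> f g [s t w fg]; split; rewrite ?src_whisker ?tgt_whisker ?wf_whisker.
- by rewrite s.
- by rewrite t.
- by [].
- by move=> /fg; apply: rbi_congW.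
Qed.

#[local] Instance sum_Proper : Proper (raw_eq ==> raw_eq ==> raw_eq) rbi_sum.
Proof.
move=> f f' ff' g g' gg'; rewrite /rbi_sum.
have [_ tg _ _] := gg'; have [sf _ _ _] := ff'.
by rewrite tg sf ff' gg'.
Qed.

(** Source, target and well-formedness are compared by computation; the equation
itself then only has to be shown for well-formed terms. *)
Lemma raw_eqI f g : rbi_src f = rbi_src g -> rbi_tgt f = rbi_tgt g ->
  rbi_wf f = rbi_wf g -> (rbi_wf f -> f ≈ g) -> f ≈ g.
Proof. by move=> s t w fg; split=> // wf; have [_ _ _] := fg wf; apply. Qed.

Lemma icompA h g f : h ∘ (g ∘ f) ≈ (h ∘ g) ∘ f.
Proof.
apply: raw_eqI => //= [|/and3P[wh /and3P[wg wf /eqP fg] /eqP gh]].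
  by rewrite -!andbA; do !bool_congr.
apply: raw_eq_of_rbi_eq.
by apply: (@rbi_compA (rbi_src f) (rbi_tgt f) (rbi_tgt g) (rbi_tgt h));
  exact/rbi_typedP.
Qed.

Lemma icomp_one0 f n : n = rbi_src f -> f ∘ IOne 0 n ≈ f.
Proof.
move=> ->; apply: raw_eqI => //=; first by rewrite eqxx !andbT.
move=> /andP[wf _]; apply: raw_eq_of_rbi_eq.
by apply: (@rbi_compf1 (rbi_src f) (rbi_tgt f)); apply/rbi_typedP.
Qed.

Lemma one0_icomp f n : n = rbi_tgt f -> IOne 0 n ∘ f ≈ f.
Proof.
move=> ->; apply: raw_eqI => //=; first by rewrite eqxx !andbT.
move=> /andP[wf _]; apply: raw_eq_of_rbi_eq.
by apply: (@rbi_comp1f (rbi_src f) (rbi_tgt f)); apply/rbi_typedP.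
Qed.

(** The equation for [IOne 1 0], whiskered, moves the strands over one at a
time. *)
Lemma IOneE n m : IOne n m ≈ IOne 0 (n + m).
Proof.
elim: n m => [|n IHn] m //; rewrite addSnnS -IHn.
have := whisker_Proper n m (raw_eq_of_rbi_eq rbi_one).
by rewrite /= addn1 addn0.
Qed.

Lemma icomp_one f n m : n + m = rbi_src f -> f ∘ IOne n m ≈ f.
Proof. by move=> e; rewrite IOneE icomp_one0. Qed.

Lemma one_icomp f n m : n + m = rbi_tgt f -> IOne n m ∘ f ≈ f.
Proof. by move=> e; rewrite IOneE one0_icomp. Qed.

Lemma nat_nabla f n : n = rbi_src f ->
  f ∘ IGen 0 Nabla n 0 ≈ IGen 0 Nabla (rbi_tgt f) 0 ∘ rbi_sum f f.
Proof.
move=> ->; apply: raw_eqI; rewrite /= ?wf_whisker ?src_whisker ?tgt_whisker;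
  rewrite ?add0n ?addn0 //.
- by rewrite mul2n addnn.
- by rewrite mul2n -addnn !eqxx /= !andbT andbb.
move=> /andP[wf _]; apply: raw_eq_of_rbi_eq.
by apply: (@rbi_nat_nabla (rbi_src f) (rbi_tgt f)); apply/rbi_typedP.
Qed.

Lemma nat_delta f n : n = rbi_tgt f ->
  IGen 0 Delta n 0 ∘ f ≈ rbi_sum f f ∘ IGen 0 Delta (rbi_src f) 0.
Proof.
move=> ->; apply: raw_eqI; rewrite /= ?wf_whisker ?src_whisker ?tgt_whisker;
  rewrite ?add0n ?addn0 //.
- by rewrite mul2n addnn.
- by rewrite mul2n -addnn !eqxx /= !andbT andbb.
move=> /andP[wf _]; apply: raw_eq_of_rbi_eq.
by apply: (@rbi_nat_delta (rbi_src f) (rbi_tgt f)); apply/rbi_typedP.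
Qed.

Lemma nat_u f n : rbi_wf f -> n = rbi_src f ->
  f ∘ IGen 0 U n 0 ≈ IGen 0 U (rbi_tgt f) 0.
Proof.
move=> wf ->; apply: raw_eq_of_rbi_eq.
by apply: (@rbi_nat_u (rbi_src f) (rbi_tgt f)); apply/rbi_typedP.
Qed.

Lemma nat_eps f n : rbi_wf f -> n = rbi_tgt f ->
  IGen 0 Eps n 0 ∘ f ≈ IGen 0 Eps (rbi_src f) 0.
Proof.
move=> wf ->; apply: raw_eq_of_rbi_eq.
by apply: (@rbi_nat_eps (rbi_src f) (rbi_tgt f)); apply/rbi_typedP.
Qed.

Lemma whisker00 f : rbi_whisker 0 0 f = f.
Proof. by elim: f => //= [k l|k th i l|g -> f ->] //; rewrite !addn0. Qed.

(** The interchange equation of the generators extends to all terms, first along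
[g] and then along [f]. *)
Lemma interchange f g r : rbi_wf f -> rbi_wf g ->
  rbi_whisker (rbi_tgt f + r) 0 g ∘ rbi_whisker 0 (r + rbi_src g) f ≈
  rbi_whisker 0 (r + rbi_tgt g) f ∘ rbi_whisker (rbi_src f + r) 0 g.
Proof.
elim: f g r => [a b|a xi i b|f2 IH2 f1 IH1] g r wf wg.
- rewrite icomp_one ?one_icomp //= ?src_whisker ?tgt_whisker; lia.
- elim: g wg => [c d|c th j d|g2 IH2 g1 IH1] wg.
  + rewrite icomp_one ?one_icomp //= ; lia.
  + have := whisker_Proper a d
      (raw_eq_of_rbi_eq (rbi_interchange xi th i j (b + r + c))).
    by rewrite /= !(addn0, add0n, addnA).
  + move: wg => /and3P[wg2 wg1 /eqP e].
    have IH1' := IH1 wg1; have IH2' := IH2 wg2.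
    rewrite -[rbi_whisker _ 0 _]/(rbi_whisker _ 0 g2 ∘ rbi_whisker _ 0 g1).
    rewrite -[rbi_src (g2 ∘ g1)]/(rbi_src g1) -[rbi_tgt (g2 ∘ g1)]/(rbi_tgt g2).
    rewrite -[rbi_whisker (_ + r) 0 (g2 ∘ g1)]/(rbi_whisker _ 0 g2 ∘
                                                rbi_whisker _ 0 g1).
    by rewrite -icompA IH1' e icompA IH2' -icompA.
- move: wf => /and3P[wf2 wf1 /eqP e].
  rewrite -[rbi_src (f2 ∘ f1)]/(rbi_src f1) -[rbi_tgt (f2 ∘ f1)]/(rbi_tgt f2).
  rewrite -!/(rbi_whisker 0 _ f2 ∘ rbi_whisker 0 _ f1).
  by rewrite icompA (IH2 g r) // -icompA -e (IH1 g r) // icompA.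
Qed.

Local Notation "f ⊕ g" := (rbi_sum f g) (at level 50, left associativity).

Lemma sum_comp f2 g2 f1 g1 : rbi_wf g2 -> rbi_wf f1 ->
  rbi_tgt f1 = rbi_src f2 -> rbi_tgt g1 = rbi_src g2 ->
  (f2 ⊕ g2) ∘ (f1 ⊕ g1) ≈ (f2 ∘ f1) ⊕ (g2 ∘ g1).
Proof.
move=> wg wf ef eg.
have := @interchange f1 g2 0 wf wg; rewrite !addn0 !add0n => I.
rewrite /rbi_sum -icompA (icompA (rbi_whisker (rbi_src f2) 0 g2)) -ef eg I.
by rewrite -icompA icompA.
Qed.

Lemma sum_one f n m : f ⊕ IOne n m ≈ rbi_whisker 0 (n + m) f.
Proof. by rewrite /rbi_sum icomp_one // src_whisker /=; lia. Qed.

Lemma one_sum f n m : IOne n m ⊕ f ≈ rbi_whisker (n + m) 0 f.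
Proof. by rewrite /rbi_sum one_icomp // tgt_whisker /=; lia. Qed.

(** * Biproducts *)

Definition in1 k l := IGen k U l 0.
Definition in2 k l := IGen 0 U k l.
Definition pr1 k l := IGen k Eps l 0.
Definition pr2 k l := IGen 0 Eps k l.

(** The identity of [k + l] is the codiagonal after the sum of the two
injections, and naturality of the codiagonal moves [h] inside. *)
Lemma copair_decomp h k l : rbi_wf h -> rbi_src h = k + l ->
  h ≈ IGen 0 Nabla (rbi_tgt h) 0 ∘ ((h ∘ in1 k l) ⊕ (h ∘ in2 k l)).
Proof.
move=> wf sh; rewrite -sum_comp ?sh /= ?addn0 //.
rewrite icompA -nat_nabla // -icompA.
rewrite -[in1 k l ⊕ _]/(IGen k U l 0 ⊕ IGen 0 U k l).
by rewrite sh (raw_eq_of_rbi_eq (rbi_nabla_uu k l)) icomp_one.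
Qed.

Lemma pair_decomp h k l : rbi_wf h -> rbi_tgt h = k + l ->
  h ≈ ((pr1 k l ∘ h) ⊕ (pr2 k l ∘ h)) ∘ IGen 0 Delta (rbi_src h) 0.
Proof.
move=> wf th; rewrite -sum_comp ?th /= ?addn0 //.
rewrite -icompA -nat_delta // icompA.
rewrite -[pr1 k l ⊕ _]/(IGen k Eps l 0 ⊕ IGen 0 Eps k l).
by rewrite th (raw_eq_of_rbi_eq (rbi_epseps_delta k l)) one_icomp.
Qed.

(** The object [0] is terminal, because the counit is natural and is the
identity at [0]. *)
Lemma icomp_tgt0 h : rbi_wf h -> rbi_tgt h = 0 -> h ≈ IGen 0 Eps (rbi_src h) 0.
Proof.
move=> wf th; rewrite -(nat_eps (n := 0)) // (raw_eq_of_rbi_eq rbi_eps0).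
by rewrite one_icomp.
Qed.

Lemma icomp_src0 h : rbi_wf h -> rbi_src h = 0 -> h ≈ IGen 0 U (rbi_tgt h) 0.
Proof.
move=> wf th; rewrite -(nat_u (n := 0)) // (raw_eq_of_rbi_eq rbi_u0).
by rewrite icomp_one.
Qed.

(** The identity and the zero arrow of [1]. *)
Definition bit (b : bool) : rbi_raw :=
  if b then IOne 0 1 else IGen 0 U 1 0 ∘ IGen 0 Eps 1 0.

(** Addition of entries is disjunction: zero is neutral because the unit and
counit equations hold, and [1 + 1 = 1] is separability. *)
Lemma bit_or b c :
  IGen 0 Nabla 1 0 ∘ (bit b ⊕ bit c) ∘ IGen 0 Delta 1 0 ≈ bit (b || c).
Proof.
case: b c => [] []; rewrite [_ || _]/=.
- by rewrite one_sum /= icomp_one // (raw_eq_of_rbi_eq (rbi_nabla_delta 1)).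
- rewrite one_sum /= icompA (raw_eq_of_rbi_eq (rbi_nabla_ku 1)) one_icomp //.
  exact: raw_eq_of_rbi_eq (rbi_keps_delta 1).
- rewrite sum_one /= icompA (raw_eq_of_rbi_eq (rbi_nabla_uk 1)) one_icomp //.
  exact: raw_eq_of_rbi_eq (rbi_epsk_delta 1).
- have e : bit false ∘ IGen 0 Nabla 1 0 ≈
      IGen 0 Nabla 1 0 ∘ (bit false ⊕ bit false) by apply: nat_nabla.
  rewrite -/(bit false) -e -icompA (raw_eq_of_rbi_eq (rbi_nabla_delta 1)).
  by rewrite icomp_one.
Qed.

Definition is_bit f := exists b, f ≈ bit b.

(** All entries of the column [a : 1 -> n] are identities or zeros. *)
Fixpoint bit_column n (a : rbi_raw) : Prop :=
  if n is n'.+1 then is_bit (pr1 1 n' ∘ a) /\ bit_column n' (pr2 1 n' ∘ a)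
  else True.

Lemma is_bit_equiv f g : f ≈ g -> is_bit g -> is_bit f.
Proof. by move=> fg [b gb]; exists b; rewrite fg. Qed.

Lemma bit_column_equiv n f g : f ≈ g -> bit_column n g -> bit_column n f.
Proof.
elim: n f g => //= n IHn f g fg [b bb]; split.
  by apply: is_bit_equiv b; rewrite fg.
by apply: IHn bb; rewrite fg.
Qed.

Lemma pr11 m l : pr1 1 m ∘ pr1 m.+1 l ≈ pr1 1 (m + l).
Proof.
have e : IGen 0 Eps m 0 ∘ IGen m Eps l 0 ≈ IGen 0 Eps (m + l) 0.
  by rewrite nat_eps /= ?addn0.
by have := whisker_Proper 1 0 e; rewrite /= !addn0.
Qed.

Lemma pr12 m l : pr2 1 m ∘ pr1 m.+1 l ≈ pr1 m l ∘ pr2 1 (m + l).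
Proof.
have := raw_eq_of_rbi_eq (rbi_interchange Eps Eps 1 l m).
by rewrite /= !add0n addn0 => e; rewrite -e.
Qed.

Lemma pr22 m l : pr2 m l ∘ pr2 1 (m + l) ≈ pr2 m.+1 l.
Proof.
have e : IGen 0 Eps m 0 ∘ IGen 0 Eps 1 m ≈ IGen 0 Eps m.+1 0.
  by rewrite nat_eps.
by have := whisker_Proper 0 l e; rewrite /= add0n.
Qed.

(** The definition peels off entries one at a time, whereas the generators call
for blocks of arbitrary size. *)
Lemma bit_column_split m l a : rbi_tgt a = m + l ->
  bit_column (m + l) a <->
  bit_column m (pr1 m l ∘ a) /\ bit_column l (pr2 m l ∘ a).
Proof.
elim: m a => [|m IHm] a ta.
  have e : pr2 0 l ∘ a ≈ a.
    have e : pr2 0 l ≈ IOne 0 l :=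
      whisker_Proper 0 l (raw_eq_of_rbi_eq rbi_eps0).
    by rewrite e one_icomp.
  split=> [b|[_]]; first by split=> //; apply: bit_column_equiv b.
  by apply: bit_column_equiv; rewrite e.
have := IHm (pr2 1 (m + l) ∘ a); rewrite /= add0n => /(_ erefl) {}IHm.
split=> [[b /IHm[b1 b2]]|[[b b1] b2]].
  split; last by apply: bit_column_equiv b2; rewrite icompA pr22.
  split; first by apply: is_bit_equiv b; rewrite icompA pr11.
  by apply: bit_column_equiv b1; rewrite !icompA pr12.
split; first by apply: is_bit_equiv b; rewrite icompA pr11.
apply/IHm; split; last by apply: bit_column_equiv b2; rewrite icompA pr22.
by apply: bit_column_equiv b1; rewrite !icompA pr12.
Qed.

Lemma bit_column_u k a : rbi_wf a -> rbi_src a = 1 -> rbi_tgt a = 0 ->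
  bit_column k (IGen 0 U k 0 ∘ a).
Proof.
move=> wf sa ta; elim: k => //= k IHk; split.
  exists false; rewrite icompA (nat_u (f := pr1 1 k)) /= ?addn0 //.
  by rewrite {1}(icomp_tgt0 wf ta) sa.
by apply: bit_column_equiv IHk; rewrite icompA (nat_u (f := pr2 1 k)) /= ?addn0.
Qed.

(** The entries of a sum of two columns are the sums of their entries. *)
Lemma bit_column_nabla k a b : rbi_wf a -> rbi_src a = 1 -> rbi_tgt a = k ->
  rbi_wf b -> rbi_src b = 1 -> rbi_tgt b = k ->
  bit_column k a -> bit_column k b ->
  bit_column k (IGen 0 Nabla k 0 ∘ (a ⊕ b) ∘ IGen 0 Delta 1 0).
Proof.
elim: k a b => //= k IHk a b wa sa ta wb sb tb [[i ia] ba] [[j jb] bb].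
have E p n : rbi_wf p -> rbi_src p = k.+1 -> rbi_tgt p = n ->
    p ∘ (IGen 0 Nabla k.+1 0 ∘ (a ⊕ b) ∘ IGen 0 Delta 1 0) ≈
    IGen 0 Nabla n 0 ∘ ((p ∘ a) ⊕ (p ∘ b)) ∘ IGen 0 Delta 1 0.
  move=> wp sp tp; rewrite icompA (icompA p) nat_nabla ?sp // tp.
  by rewrite -(icompA _ (p ⊕ p)) sum_comp ?sp.
split.
  exists (i || j); rewrite (E _ 1) //= ?addn0 //.
  by rewrite ia jb bit_or.
apply: bit_column_equiv (E _ k _ _ _) _; rewrite //= ?addn0 //.
by apply: IHk; rewrite //= ?wa ?wb ?ta ?tb ?eqxx.
Qed.

Definition preserves_bits f := forall a, rbi_wf a -> rbi_src a = 1 ->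
  rbi_tgt a = rbi_src f ->
  bit_column (rbi_src f) a -> bit_column (rbi_tgt f) (f ∘ a).

(** The projections of a whiskered term to its two blocks are [f] after a
projection, by interchange, and a projection, by naturality of the counit. *)
Lemma preserves_bits_right f m : rbi_wf f -> preserves_bits f ->
  preserves_bits (rbi_whisker 0 m f).
Proof.
move=> wf fP a wa sa; rewrite src_whisker tgt_whisker /= => ta.
move/(bit_column_split ta) => [b1 b2].
apply/bit_column_split; first by rewrite /= tgt_whisker.
split.
  have e : pr1 (rbi_tgt f) m ∘ rbi_whisker 0 m f ≈ f ∘ pr1 (rbi_src f) m.
    have := @interchange f (IGen 0 Eps m 0) 0 wf isT.
    by rewrite /= !addn0 !add0n whisker00.
  apply: bit_column_equiv (fP (pr1 (rbi_src f) m ∘ a) _ _ _ b1) => //=.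
  - by rewrite !icompA e.
  - by rewrite wa ta addn0 eqxx.
  - by rewrite !addn0.
have e : IGen 0 Eps (rbi_tgt f) 0 ∘ f ≈ IGen 0 Eps (rbi_src f) 0.
  by rewrite nat_eps.
have {}e := whisker_Proper 0 m e.
by apply: bit_column_equiv b2; rewrite icompA; apply: IComp_Proper.
Qed.

Lemma preserves_bits_left f m : rbi_wf f -> preserves_bits f ->
  preserves_bits (rbi_whisker m 0 f).
Proof.
move=> wf fP a wa sa; rewrite src_whisker tgt_whisker !addn0 /= => ta.
move/(bit_column_split ta) => [b1 b2].
apply/bit_column_split; first by rewrite /= tgt_whisker addn0.
split; last first.
  have e : pr2 m (rbi_tgt f) ∘ rbi_whisker m 0 f ≈ f ∘ pr2 m (rbi_src f).
    have := @interchange (IGen 0 Eps m 0) f 0 isT wf.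
    by rewrite /= !addn0 !add0n whisker00 => ->.
  apply: bit_column_equiv (fP (pr2 m (rbi_src f) ∘ a) _ _ _ b2) => //=.
  - by rewrite !icompA e.
  - by rewrite wa ta eqxx.
have e : IGen 0 Eps (rbi_tgt f) 0 ∘ f ≈ IGen 0 Eps (rbi_src f) 0.
  by rewrite nat_eps.
have := whisker_Proper m 0 e; rewrite /= !addn0 => {}e.
by apply: bit_column_equiv b1; rewrite icompA e.
Qed.

Lemma preserves_bits_gen th k : preserves_bits (IGen 0 th k 0).
Proof.
case: th => a wa sa; rewrite /= !addn0 => ta.
- rewrite add0n mul2n -addnn in ta * => /(bit_column_split (m := k) ta)[b1 b2].
  have := bit_column_nabla _ _ _ _ _ _ b1 b2.
  rewrite /= wa ta !addn0 eqxx => /(_ isT sa erefl isT sa erefl).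
  by apply: bit_column_equiv; rewrite -icompA -sa -pair_decomp.
- rewrite !add0n mul2n -addnn => ba; apply/bit_column_split.
    by rewrite /= addn0 mul2n addnn.
  split; apply: bit_column_equiv ba; rewrite icompA.
  + by rewrite (raw_eq_of_rbi_eq (rbi_keps_delta k)) one_icomp.
  + by rewrite (raw_eq_of_rbi_eq (rbi_epsk_delta k)) one_icomp.
- by move=> _; apply: bit_column_u.
- by [].
Qed.

Lemma preserves_bitsP f : rbi_wf f -> preserves_bits f.
Proof.
elim: f => [n m|n th k m|g IHg f IHf] /=.
- move=> _ a wa sa ta; apply: bit_column_equiv.
  by rewrite one_icomp.
- move=> _.
  have P : preserves_bits (IGen 0 th k m).
    exact: (@preserves_bits_right (IGen 0 th k 0) m isT
             (@preserves_bits_gen th k)).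
  by have := @preserves_bits_left (IGen 0 th k m) n isT P; rewrite /= !addn0.
- move=> /and3P[/IHg {}IHg wf /eqP e] a wa sa ta ba /=.
  apply: bit_column_equiv (IHg (f ∘ a) _ _ _ _); rewrite ?icompA //=.
    by rewrite wf wa ta eqxx.
  by rewrite -e; apply: IHf.
Qed.

(** The identity of [1] is a column of bits, hence so is its composite with
[f]. *)
Lemma endo1_bit f : rbi_wf f -> rbi_src f = 1 -> rbi_tgt f = 1 -> is_bit f.
Proof.
move=> wf sf tf.
have pr11E : pr1 1 0 ≈ IOne 0 1.
  have := whisker_Proper 1 0 (raw_eq_of_rbi_eq rbi_eps0).
  by rewrite -(IOneE 1 0).
have := preserves_bitsP wf (a := IOne 0 1).
rewrite sf tf => /(_ isT erefl erefl).
case=> [|b _]; last first.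
  by apply: is_bit_equiv b; rewrite pr11E one_icomp ?icomp_one.
by split=> //; exists true; rewrite pr11E one_icomp.
Qed.

Lemma copair_ext k l f g : rbi_wf f -> rbi_wf g -> rbi_src f = k + l ->
  rbi_src g = k + l -> rbi_tgt f = rbi_tgt g ->
  f ∘ in1 k l ≈ g ∘ in1 k l -> f ∘ in2 k l ≈ g ∘ in2 k l -> f ≈ g.
Proof.
move=> wf wg sf sg t e1 e2.
by rewrite (copair_decomp wf sf) (copair_decomp wg sg) t e1 e2.
Qed.

Lemma pair_ext k l f g : rbi_wf f -> rbi_wf g -> rbi_tgt f = k + l ->
  rbi_tgt g = k + l -> rbi_src f = rbi_src g ->
  pr1 k l ∘ f ≈ pr1 k l ∘ g -> pr2 k l ∘ f ≈ pr2 k l ∘ g -> f ≈ g.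
Proof.
move=> wf wg sf sg t e1 e2.
by rewrite (pair_decomp wf sf) (pair_decomp wg sg) t e1 e2.
Qed.

(** Any invariant compatible with composition that separates the identity of [1]
from zero separates all arrows: the extensionality principles reduce an equation
to its entries, which are bits. *)
Lemma rbi_faithful (T : Type) (F : rbi_raw -> T) (G : T -> T -> T) :
  (forall g f, F (g ∘ f) = G (F g) (F f)) ->
  F (bit true) <> F (bit false) ->
  (forall f g, rbi_wf f -> f ≈ g -> F f = F g) ->
  forall n m f g, rbi_typed n m f -> rbi_typed n m g -> F f = F g ->
    rbi_eq n m f g.
Proof.
move=> FG F01 Fsound n m f g ft gt fg; apply/(raw_eqP _ ft).
move: ft gt fg => /rbi_typedP[wf sf tf] /rbi_typedP[wg sg tg].
elim: n f g wf sf tf wg sg tg => [|n IHn] f g wf sf tf wg sg tg fg.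
  by rewrite (icomp_src0 wf sf) (icomp_src0 wg sg) tf tg.
apply: (copair_ext (k := 1) (l := n)) => //; [by rewrite tf| | by
  apply: IHn; rewrite /= ?wf ?wg ?sf ?sg ?FG ?fg ?eqxx].
have : F (f ∘ in1 1 n) = F (g ∘ in1 1 n) by rewrite !FG fg.
have wf1 : rbi_wf (f ∘ in1 1 n) by rewrite /= wf sf addn0 eqxx.
have wg1 : rbi_wf (g ∘ in1 1 n) by rewrite /= wg sg addn0 eqxx.
move: (f ∘ _) (g ∘ _) (erefl : rbi_src (f ∘ in1 1 n) = 1)
  (erefl : rbi_src (g ∘ in1 1 n) = 1) wf1 wg1 (tf : rbi_tgt (f ∘ in1 1 n) = m)
  (tg : rbi_tgt (g ∘ in1 1 n) = m) => {sf sg tf tg IHn wf wg fg}f {}g.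
elim: m f g => [|m IHm] f g sf sg wf wg tf tg fg.
  by rewrite (icomp_tgt0 wf tf) (icomp_tgt0 wg tg) sf sg.
apply: (pair_ext (k := 1) (l := m)) => //; [by rewrite sf| | by
  apply: IHm; rewrite /= ?wf ?wg ?tf ?tg ?FG ?fg ?eqxx].
have wpf : rbi_wf (pr1 1 m ∘ f) by rewrite /= wf tf addn0 eqxx.
have wpg : rbi_wf (pr1 1 m ∘ g) by rewrite /= wg tg addn0 eqxx.
have [b eb] := endo1_bit wpf sf erefl.
have [c ec] := endo1_bit wpg sg erefl.
have : F (bit b) = F (bit c).
  by rewrite -(Fsound _ _ wpf eb) -(Fsound _ _ wpg ec) !FG fg.
rewrite eb ec => bc.
suff -> : b = c by [].
by case: b c bc {eb ec} => [] [] // /esym.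
Qed.

(** * Denotation of terms with biproducts *)

Fixpoint rbi_den (f : rbi_raw) : stream -> stream :=
  match f with
  | IOne _ _ => id
  | IGen n th k _ => iter n lift_op (gen_op th k)
  | IComp g f => rbi_den g \o rbi_den f
  end.

Lemma iter_lift_opE n D s i :
  iter n lift_op D s i = if i < n then s i else D (fun j => s (n + j)) (i - n).
Proof.
elim: n s i => [|n IHn] s [|i] //=.
by rewrite IHn.
Qed.

Lemma iter_lift_op_head n D s i : i < n -> iter n lift_op D s i = s i.
Proof. by rewrite iter_lift_opE => ->. Qed.

Lemma iter_lift_op_tail n D s i :
  iter n lift_op D s (n + i) = D (fun j => s (n + j)) i.
Proof. by rewrite iter_lift_opE ltnNge leq_addr addKn. Qed.

Lemma linear_iter_lift_op k n m D :
  linear n m D -> linear (k + n) (k + m) (iter k lift_op D).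
Proof. by move=> L; elim: k => //= k; apply: linear_lift_op. Qed.

Lemma rbi_den_whisker n m f :
  rbi_den (rbi_whisker n m f) = iter n lift_op (rbi_den f).
Proof.
elim: f => [k l|k th i l|g IHg f IHf] /=; last 1 first.
- rewrite IHg IHf; apply: funext => s; apply: funext => i /=.
  rewrite !iter_lift_opE; case: ltnP => // ni; congr (rbi_den g _ _).
  by apply: funext => j; rewrite iter_lift_op_tail.
- elim: n => // n IHn; rewrite iterS -IHn.
  by apply: funext => s; apply: funext => -[].
- by rewrite iterD.
Qed.

Lemma linear_rbi_den f : rbi_wf f -> linear (rbi_src f) (rbi_tgt f) (rbi_den f).
Proof.
elim: f => [n m _|n th k m _|g IHg f IHf] /=; first exact: linear_id.
  exact/linear_widen/linear_iter_lift_op/linear_gen.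
move=> /and3P[/IHg Lg /IHf Lf /eqP e].
by apply: linear_comp Lg _; rewrite -e.
Qed.

(** [D] works on the first [p] bits and [E] on bits after the [p]-th, which [D]
only renumbers. *)
Lemma linear_interchange p q D E : linear p q D ->
  iter q lift_op E \o D = D \o iter p lift_op E.
Proof.
move=> L; apply: funext => s; apply: funext => i /=; have [iq|qi] := ltnP i q.
  rewrite iter_lift_op_head //; apply: (lin_local L) iq => j jp.
  by rewrite iter_lift_op_head.
rewrite -(subnKC qi) iter_lift_op_tail (lin_tail L) iter_lift_op_tail.
by congr (E _ _); apply: funext => j; rewrite (lin_tail L).
Qed.

Section LinearNaturality.
Variables (n m : nat) (D : stream -> stream).
Hypothesis L : linear n m D.

Lemma linear_nabla :
  D \o gen_op Nabla n = gen_op Nabla m \o (D \o iter n lift_op D).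
Proof.
apply: funext => s; apply: funext => i /=.
rewrite (lin_tail L) iter_lift_op_tail; case: ltnP => im.
  rewrite (lin_local L (t := join s (fun j => s (n + j)))) //.
    rewrite (lin_or L) /join; congr (_ || _); apply: (lin_local L) im => j jn.
    by rewrite iter_lift_op_head.
  by move=> j jn; rewrite jn.
by rewrite -(subnKC im) !(lin_tail L) ltnNge leq_addr.
Qed.

Lemma linear_delta :
  gen_op Delta m \o D = (D \o iter n lift_op D) \o gen_op Delta n.
Proof.
apply: funext => s; apply: funext => i /=; case: ltnP => im.
  by apply: (lin_local L) im => j jn; rewrite iter_lift_op_head ?jn.
rewrite -{2}(subnKC im) (lin_tail L) iter_lift_op_tail.
by congr (D _ _); apply: funext => j; rewrite ltnNge leq_addr addKn.
Qed.

Lemma linear_u : D \o gen_op U n = gen_op U m.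
Proof.
apply: funext => s; apply: funext => i /=; case: ltnP => im.
  rewrite (lin_local L (t := xpred0)) ?(lin_0 L) // => j jn.
  by rewrite jn.
by rewrite -{1}(subnKC im) (lin_tail L) ltnNge leq_addr addKn.
Qed.

Lemma linear_eps : gen_op Eps m \o D = gen_op Eps n.
Proof. by apply: funext => s; apply: funext => i /=; apply: (lin_tail L). Qed.

End LinearNaturality.

(* Each condition is decided by linear arithmetic from the position of the index
   relative to the block boundaries. *)
Ltac decide_ifs := repeat match goal with
  | |- context [if ?c then _ else _] =>
    first [rewrite (_ : c = true); last lia | rewrite (_ : c = false); last lia]
  | |- context [iter ?n lift_op ?D ?s ?i] => rewrite (iter_lift_opE n D s i) /=
  end.

Ltac split_at i k :=
  case: (ltnP i k) => ?; decide_ifs; rewrite ?addKn ?orbF ?orFb ?orbb //;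
  congr (_ _); lia.

(** Naturality of the generators holds because denotations are linear; the
remaining equations are checked bit by bit. *)
Lemma rbi_den_sound n m f g : rbi_eq n m f g -> rbi_den f = rbi_den g.
Proof.
have lin n' m' f' : rbi_typed n' m' f' -> linear n' m' (rbi_den f').
  by move=> /rbi_typedP[wf <- <-]; apply: linear_rbi_den.
have sumE f1 f2 : rbi_den (rbi_sum f1 f2) =
    rbi_den f1 \o iter (rbi_src f1) lift_op (rbi_den f2).
  by rewrite /= !rbi_den_whisker.
elim=> {n m f g} //.
- by move=> n m f g h _ -> _ ->.
- by move=> a b n m f g _ e; rewrite !rbi_den_whisker e.
- by move=> n m k g g' f f' _ /= -> _ ->.
- move=> xi th i j r p q s t /=; rewrite !iterD; apply: linear_interchange.
  exact: linear_gen.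
- move=> n m f ft; have [_ sf _] := (rbi_typedP _ _ _).1 ft.
  rewrite -[RHS]/(gen_op Nabla m \o rbi_den (rbi_sum f f)) sumE sf.
  exact/linear_nabla/lin.
- move=> n m f ft; have [_ sf _] := (rbi_typedP _ _ _).1 ft.
  rewrite -[RHS]/(rbi_den (rbi_sum f f) \o gen_op Delta n) sumE sf.
  exact/linear_delta/lin.
- by move=> n m f ft /=; apply/linear_u/lin.
- by move=> n m f ft /=; apply/linear_eps/lin.
- by move=> k; apply: funext => s; apply: funext => i /=; split_at i k.
- by move=> k; apply: funext => s; apply: funext => i /=; split_at i k.
- move=> k l; apply: funext => s; apply: funext => i /=.
  by case: (ltnP i (k + l)) => ?; split_at i k.
- by move=> k; apply: funext => s; apply: funext => i /=; split_at i k.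
- by move=> k; apply: funext => s; apply: funext => i /=; split_at i k.
- move=> k l; apply: funext => s; apply: funext => i /=.
  by case: (ltnP i (k + l)) => ?; split_at i k.
- by apply: funext => s; apply: funext => i /=; rewrite subn0.
- by move=> k; apply: funext => s; apply: funext => i /=; split_at i k.
Qed.

Lemma rbi_complete n m f g : rbi_typed n m f -> rbi_typed n m g ->
  rbi_den f = rbi_den g -> rbi_eq n m f g.
Proof.
move=> ft gt; apply: (rbi_faithful (G := fun D D' => D \o D')) ft gt => //.
  by move/(congr1 (fun D => D xpredT 0)).
by move=> f' g' wf [_ _ _ /(_ wf)]; apply: rbi_den_sound.
Qed.

(** The column with entries [c], the pairing of its entries. *)
Fixpoint column m (c : nat -> bool) : rbi_raw :=
  if m is m'.+1 then
    IComp (rbi_sum (bit (c 0)) (column m' (c \o succn))) (IGen 0 Delta 1 0)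
  else IGen 0 Eps 1 0.

(** The arrow with matrix [R], the copairing of its columns. *)
Fixpoint matrix_term n m (R : nat -> nat -> bool) : rbi_raw :=
  if n is n'.+1 then
    IComp (IGen 0 Nabla m 0)
      (rbi_sum (column m (R 0)) (matrix_term n' m (R \o succn)))
  else IGen 0 U m 0.

Lemma bit_typed b : rbi_typed 1 1 (bit b).
Proof. by case: b. Qed.

Lemma column_typed m c : rbi_typed 1 m (column m c).
Proof.
elim: m c => //= m IHm c; apply: (rbi_typed_comp (m := 1 + 1)) => //.
exact: rbi_typed_sum (bit_typed _) (IHm _).
Qed.

Lemma matrix_term_typed n m R : rbi_typed n m (matrix_term n m R).
Proof.
elim: n R => [|n IHn] R /=; first by rewrite /rbi_typed /= addn0 eqxx.
apply: (rbi_typed_comp (m := m + m)).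
  by rewrite /rbi_typed /= !addn0 mul2n addnn !eqxx.
exact: rbi_typed_sum (column_typed _ _) (IHn _).
Qed.

Lemma rbi_den_sum n m f g : rbi_typed n m f ->
  rbi_den (rbi_sum f g) = rbi_den f \o iter n lift_op (rbi_den g).
Proof.
by move=> /rbi_typedP[_ sf _]; rewrite /= !rbi_den_whisker sf.
Qed.

Lemma rbi_den_bit b s : rbi_den (bit b) s 0 = b && s 0.
Proof. by case: b. Qed.

Lemma linear_typed n m f : rbi_typed n m f -> linear n m (rbi_den f).
Proof. by move=> /rbi_typedP[wf <- <-]; apply: linear_rbi_den. Qed.

Lemma rbi_den_column m c s i : i < m -> rbi_den (column m c) s i = c i && s 0.
Proof.
elim: m c s i => // m IHm c s i im.
rewrite -[LHS]/(rbi_den (rbi_sum (bit (c 0)) (column m (c \o succn))) _ i).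
rewrite (rbi_den_sum _ (bit_typed _)) /=; case: i im => [|i] im.
  by rewrite rbi_den_bit.
by rewrite (lin_tail (linear_typed (bit_typed _)) _ i) /= IHm.
Qed.

Lemma rbi_den_matrix_term n m R s j : j < m ->
  rbi_den (matrix_term n m R) s j = \big[orb/false]_(i < n) (s i && R i j).
Proof.
move=> jm; elim: n R s => [|n IHn] R s; first by rewrite big_ord0 /= jm.
set f := rbi_sum (column m (R 0)) (matrix_term n m (R \o succn)).
rewrite -[LHS]/(gen_op Nabla m (rbi_den f s) j).
rewrite (rbi_den_sum _ (column_typed _ _)) /= jm.
rewrite rbi_den_column // (lin_tail (linear_typed (column_typed _ _))) /=.
by rewrite IHn big_ord_recl andbC.
Qed.

Lemma RBI_Rel : isomorphic RBI Rel.
Proof.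
apply: (@iso_Rel rbi_term _ _ _ _ _ _ _ _ _ _
         (fun n m f => rbi_den (sval f))) => //.
- by move=> n m [f ft]; apply: linear_typed.
- move=> n m [f ft] [g gt]; split; first exact: rbi_den_sound.
  exact: rbi_complete.
- move=> n m R.
  exists (exist (fun f => rbi_typed n m f) _
            (matrix_term_typed n m (rel_matrix R))).
  by apply: (@relation_of_matrix n m R) => s j jm; rewrite rbi_den_matrix_term.
Qed.

End BiproductTerms.

Theorem mainTheorem3 :
  [/\ isomorphic RB RBI, isomorphic RBI Rel & isomorphic RB Rel].
Proof.
split; [|exact: RBI_Rel|exact: RB_Rel].
exact: isomorphic_trans RB_Rel (isomorphic_sym RBI_Rel).
Qed.
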